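(* Fix $d\in\mathbb{N}_+$, $\lambda>0$, $T\in\mathbb{N}_+$, and let $\mathcal{X}=\{\bm{x}\in\mathbb{R}^d:\|\bm{x}\|_2\le1\}$. Let $\gamma_T(\mathcal{X})=\max_{\bm{x}_1,\dots,\bm{x}_T\in\mathcal{X}}\frac12\ln\det(\bm{I}_T+\lambda^{-2}\mathbf{K}(\mathbf{X}_T,\mathbf{X}_T))$. There exist constants $C_d^{(1)},\dots,C_d^{(5)}>0$ depending only on $d$, a constant $C_\nu>0$ depending only on $\nu$, an absolute constant $C>0$, and constants $C_{d,\nu}^{(1)},C_{d,\nu}^{(2)}>0$ depending only on $d,\nu$, such that: (i) For $k=k_{\mathrm{SE}}$ with lengthscale $\ell$, set $\theta=2\ell^2$ and $c_d=\max\{1,\exp(\frac1e(\frac d2-1))\}$. If $\theta\le e^2c_d$ and $T/(e-1)\ge\lambda^2$, then $$\gamma_T(\mathcal{X})\le\frac{C_d^{(1)}}{\theta^d}\ln^{d+1}\Big(1+\frac{T}{\lambda^2}\Big)+\ln\Big(1+\frac{T}{\lambda^2}\Big)+C_d^{(2)}\exp\Big(-\frac2\theta+\frac1{\theta^2}\Big);$$ and if $\theta>e^2c_d$, then $$\gamma_T(\mathcal{X})\le\frac{C_d^{(3)}}{\ln^d(\frac{\theta}{ec_d})}\ln^{d+1}\Big(1+\frac{T}{\lambda^2}\Big)+C_d^{(4)}\ln\Big(1+\frac{T}{\lambda^2}\Big)+C_d^{(5)}.$$ (ii) For $k=k_{\mathrm{Mat\acute{e}rn}}$ with $\nu>1/2$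 and lengthscale $\ell$, $$\gamma_T(\mathcal{X})\le C(T,\nu,\lambda)\,\overline{\gamma}_T+C,$$ where $C(T,\nu,\lambda)=\max\Big\{1,\ \log_2\Big(1+\frac{\Gamma(\nu)}{C_\nu}\ln\frac{T^2}{\lambda^2}\Big)+\frac1\nu\log_2\Big(\frac{T^2}{\nu\Gamma(\nu)\lambda^2}\Big)+1\Big\}$ and $$\overline{\gamma}_T=C_{d,\nu}^{(1)}\ln\Big(1+\frac{2T}{\lambda^2}\Big)+C_{d,\nu}^{(2)}\Big(\frac{T}{\lambda^2\ell^{2\nu}}\Big)^{\frac{d}{2\nu+d}}\ln^{\frac{2\nu}{2\nu+d}}\Big(1+\frac{2T}{\lambda^2}\Big).$$
   Context: $k_{\mathrm{SE}}(\bm{x},\tilde{\bm{x}})=\exp(-\|\bm{x}-\tilde{\bm{x}}\|_2^2/(2\ell^2))$; $k_{\mathrm{Mat\acute{e}rn}}(\bm{x},\tilde{\bm{x}})=\frac{2^{1-\nu}}{\Gamma(\nu)}(\frac{\sqrt{2\nu}\|\bm{x}-\tilde{\bm{x}}\|_2}{\ell})^{\nu}K_\nu(\frac{\sqrt{2\nu}\|\bm{x}-\tilde{\bm{x}}\|_2}{\ell})$ with $K_\nu$ the modified Bessel function of the second kind. $\mathbf{K}(\mathbf{X}_T,\mathbf{X}_T)=(k(\bm{x}_i,\bm{x}_j))_{i,j\le T}$. *)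

(* Defs.v *)
From HB Require Import structures.
From mathcomp Require Import all_boot all_order all_algebra.
From mathcomp Require Import all_classical all_reals all_analysis.
Set Implicit Arguments. Unset Strict Implicit. Unset Printing Implicit Defensive.
Import Order.TTheory GRing.Theory Num.Theory.
Local Open Scope classical_set_scope.
Local Open Scope ring_scope.

Section Defs.
Variable R : realType.

Definition enorm (d : nat) (x : 'rV[R]_d) : R :=
  Num.sqrt (\sum_(i < d) x ord0 i ^+ 2).

Definition coshR (t : R) : R := (expR t + expR (- t)) / 2.

Definition GammaR (nu : R) : R :=
  fine (\int[@lebesgue_measure R]_(t in `]0%R, +oo[)
          ((t `^ (nu - 1)) * expR (- t))%:E)%E.

Definition BesselK (nu z : R) : R :=
  fine (\int[@lebesgue_measure R]_(t in `[0%R, +oo[)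
          (expR (- (z * coshR t)) * coshR (nu * t))%:E)%E.

Definition k_SE (l : R) (d : nat) (x y : 'rV[R]_d) : R :=
  expR (- (enorm (x - y) ^+ 2 / (2 * l ^+ 2))).

(* Matern kernel with smoothness nu and lengthscale l; at distance 0 it
   takes its limiting value 1. *)
Definition k_Matern (nu l : R) (d : nat) (x y : 'rV[R]_d) : R :=
  let r := enorm (x - y) in
  if r == 0 then 1 else
  let z := Num.sqrt (2 * nu) * r / l in
  2 `^ (1 - nu) / GammaR nu * z `^ nu * BesselK nu z.

Definition gram (d T : nat) (k : 'rV[R]_d -> 'rV[R]_d -> R)
  (X : 'I_T -> 'rV[R]_d) : 'M[R]_T := \matrix_(i, j) k (X i) (X j).

Definition info_gain (d T : nat) (k : 'rV[R]_d -> 'rV[R]_d -> R)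
  (lambda : R) : R :=
  sup [set v : R | exists X : 'I_T -> 'rV[R]_d,
         (forall i, enorm (X i) <= 1) /\
         v = 2^-1 * ln (\det (1%:M + lambda ^-2 *: gram k X))].

Definition log2 (x : R) : R := ln x / ln 2.

End Defs.

(* Main.v *)
Require Import Defs.
From HB Require Import structures.
From mathcomp Require Import all_boot all_order all_algebra.
From mathcomp Require Import all_classical all_reals all_analysis.
From mathcomp Require Import measurable_realfun ring lra zify.
Set Implicit Arguments. Unset Strict Implicit. Unset Printing Implicit Defensive.
Import Order.TTheory GRing.Theory Num.Theory numFieldNormedType.Exports.
Local Open Scope ring_scope.

(** Let [c = lambda^-2].  Both bounds come from one determinant inequality.  If
    [G] is the joint Gram matrix of the [T] data points and [N] auxiliary
    vectors of norm at most 1, and the rows of [A] are the coefficients of an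
    approximation of each data point by the auxiliary ones, then, for every
    [e > 0], [det (1 + c K) <= (1 + c / e)^N * prod_i (1 + e |A_i|^2 + c Res_ii)],
    where [Res_ii] is the squared error of the i-th approximation: the
    determinant of [diag(1, e) + c G] is at least [e^N det (1 + c K)] by a Schur
    complement, is unchanged by the shear that subtracts the approximations,
    and is then bounded by Hadamard's inequality.  With [e] of order [1 / T]
    the term [e |A_i|^2] contributes O(1) and each auxiliary vector costs
    O(ln (1 + T / lambda^2)).

    For the squared exponential kernel the auxiliary vectors are the tensor
    products of the first [D] Taylor features [x^n exp (- x^2 / theta)]; the
    residual is a tail of the exponential series.

    The Matern kernel is a mixture over [s] of Gaussians [exp (- rho_s |x - y|^2)]
    with weight [exp (nu s - exp s) / Gamma(nu)] and [rho_s] proportional to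
    [exp (- s) / l^2]: this is the Bessel integral after a translation of the
    variable.  The auxiliary vectors are the points of a grid of mesh [h ~ 1 / n],
    and the approximation is local polynomial interpolation of degree [m > nu - 1].
    The interpolation error annihilates polynomials of degree at most [m], so
    for a single Gaussian the residual is O(min (1, (rho h^2)^(m + 1))), and the
    mixture of these is O((h / l)^(2 nu)).  Balancing [n^d] against
    [T / lambda^2 (n l)^(- 2 nu)] gives the bound without the prefactor
    [C(T, nu, lambda)], which is at least 1. *)

(** * Determinants of positive semidefinite matrices *)

Section psd_matrices.
Variable R : realType.

Definition psd n (M : 'M[R]_n) :=
  M^T = M /\ forall v : 'rV[R]_n, 0 <= (v *m M *m v^T) 0 0.

Definition pd n (M : 'M[R]_n) :=
  M^T = M /\ forall v : 'rV[R]_n, v != 0 -> 0 < (v *m M *m v^T) 0 0.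

Lemma psdD n (M N : 'M[R]_n) : psd M -> psd N -> psd (M + N).
Proof.
move=> [sM pM] [sN pN]; split; first by rewrite linearD /= sM sN.
by move=> v; rewrite mulmxDr mulmxDl mxE addr_ge0.
Qed.

Lemma psdZ n (c : R) (M : 'M[R]_n) : 0 <= c -> psd M -> psd (c *: M).
Proof.
move=> c0 [sM pM]; split; first by rewrite linearZ /= sM.
by move=> v; rewrite -scalemxAr -scalemxAl mxE mulr_ge0.
Qed.

Lemma mulmx_tr_ge0 n (v : 'rV[R]_n) : 0 <= (v *m v^T) 0 0.
Proof. by rewrite mxE sumr_ge0// => i _; rewrite mxE -expr2 sqr_ge0. Qed.

Lemma mulmx_tr_gt0 n (v : 'rV[R]_n) : v != 0 -> 0 < (v *m v^T) 0 0.
Proof.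
move=> v0; rewrite lt_neqAle mulmx_tr_ge0 andbT eq_sym; apply: contra v0.
rewrite mxE psumr_eq0; last by move=> i _; rewrite mxE -expr2 sqr_ge0.
move=> /allP h; apply/eqP/rowP => i; rewrite !mxE.
by have := h i (mem_index_enum i); rewrite mxE /= mulf_eq0 orbb => /eqP.
Qed.

Lemma pdD n (M N : 'M[R]_n) : pd M -> psd N -> pd (M + N).
Proof.
move=> [sM pM] [sN pN]; split; first by rewrite linearD /= sM sN.
by move=> v v0; rewrite mulmxDr mulmxDl mxE ltr_wpDr ?pM.
Qed.

Lemma pd_scalar n (c : R) : 0 < c -> pd (c%:M : 'M[R]_n).
Proof.
move=> c0; split; first by rewrite tr_scalar_mx.
by move=> v v0; rewrite mul_mx_scalar -scalemxAl mxE mulr_gt0 ?mulmx_tr_gt0.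
Qed.

Lemma psd_conj m n (U : 'M[R]_(m, n)) (M : 'M[R]_n) :
  psd M -> psd (U *m M *m U^T).
Proof.
move=> [sM pM]; split; first by rewrite !trmx_mul trmxK sM mulmxA.
by move=> v; have := pM (v *m U); rewrite trmx_mul !mulmxA.
Qed.

Lemma pd_conj n (U M : 'M[R]_n) : U \in unitmx -> pd M -> pd (U *m M *m U^T).
Proof.
move=> uU [sM pM]; split; first by rewrite !trmx_mul trmxK sM mulmxA.
move=> v v0; have := pM (v *m U); rewrite trmx_mul !mulmxA; apply.
by apply: contra v0 => /eqP h; rewrite -(mulmxK uU v) h mul0mx.
Qed.

Definition schur m n (M : 'M[R]_(m + n)) : 'M[R]_n :=
  drsubmx M - dlsubmx M *m invmx (ulsubmx M) *m ursubmx M.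

Lemma det_schur m n (M : 'M[R]_(m + n)) : ulsubmx M \in unitmx ->
  \det M = \det (ulsubmx M) * \det (schur M).
Proof.
move=> uA; rewrite -{1}(submxK M).
have -> : block_mx (ulsubmx M) (ursubmx M) (dlsubmx M) (drsubmx M) =
   block_mx (ulsubmx M) 0 (dlsubmx M) 1%:M *m
   block_mx 1%:M (invmx (ulsubmx M) *m ursubmx M) 0 (schur M).
  rewrite mulmx_block !mulmx1 !mul0mx !mulmx0 !addr0 mul1mx mulKVmx//.
  by rewrite /schur mulmxA addrC subrK.
by rewrite det_mulmx det_lblock det_ublock !det1 mulr1 mul1r.
Qed.

(** The first block of [w] is chosen to make [w *m M] vanish on that block, so the form of [M] at
    [w] reduces to that of the Schur complement at [v]. Positivity of [M] thus passes to
    [schur M]. *)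
Lemma schur_quad m n (M : 'M[R]_(m + n)) (v : 'rV[R]_n) :
  ulsubmx M \in unitmx -> M^T = M ->
  v *m schur M *m v^T =
    let w := row_mx (- (v *m dlsubmx M *m invmx (ulsubmx M))) v in
    w *m M *m w^T.
Proof.
move=> uA sM /=; rewrite -{4}(submxK M) mul_row_block !mulNmx.
rewrite mulmxKV// addNr tr_row_mx mul_row_col mul0mx add0r /schur.
by rewrite mulmxBr !mulmxA addrC.
Qed.

Lemma sym_blocks m n (M : 'M[R]_(m + n)) : M^T = M ->
  [/\ (ulsubmx M)^T = ulsubmx M, (dlsubmx M)^T = ursubmx M,
      (ursubmx M)^T = dlsubmx M & (drsubmx M)^T = drsubmx M].
Proof. by move=> sM; split; rewrite -{2}sM ?trmx_ulsub ?trmx_dlsub ?trmx_ursub ?trmx_drsub. Qed.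

Lemma schur_sym m n (M : 'M[R]_(m + n)) : M^T = M -> (schur M)^T = schur M.
Proof.
move=> /sym_blocks[a b c d]; rewrite /schur linearB /= !trmx_mul d b c.
by rewrite trmx_inv a mulmxA.
Qed.

Lemma psd_schur m n (M : 'M[R]_(m + n)) :
  ulsubmx M \in unitmx -> psd M -> psd (schur M).
Proof.
by move=> uA [sM pM]; split; [exact: schur_sym|move=> v; rewrite schur_quad].
Qed.

Lemma pd_schur m n (M : 'M[R]_(m + n)) :
  ulsubmx M \in unitmx -> pd M -> pd (schur M).
Proof.
move=> uA [sM pM]; split; first exact: schur_sym.
move=> v v0; rewrite schur_quad//=; apply: pM.
by apply: contra v0 => /eqP; rewrite -[0 in X in _ = X]row_mx0 => /eq_row_mx[_ ->].
Qed.

Lemma submxD m n (A B : 'M[R]_(m + n)) :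
  (ulsubmx (A + B) = ulsubmx A + ulsubmx B) * (ursubmx (A + B) = ursubmx A + ursubmx B)
  * (dlsubmx (A + B) = dlsubmx A + dlsubmx B) * (drsubmx (A + B) = drsubmx A + drsubmx B).
Proof. by do !split; apply/matrixP => i j; rewrite !mxE. Qed.

Lemma pd_diag n (M : 'M[R]_n) i : pd M -> 0 < M i i.
Proof.
move=> [_ pM]; have := pM (delta_mx 0 i).
rewrite -rowE mxE (bigD1 i)//= big1 ?addr0.
  rewrite !mxE !eqxx mulr1; apply; apply/eqP => /rowP/(_ i).
  by rewrite !mxE !eqxx => /eqP; rewrite oner_eq0.
by move=> j ji; rewrite !mxE (negbTE ji) andbF mulr0.
Qed.

Lemma psd_diag n (M : 'M[R]_n) i : psd M -> 0 <= M i i.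
Proof.
move=> [_ pM]; have := pM (delta_mx 0 i).
rewrite -rowE mxE (bigD1 i)//= big1 ?addr0.
  by rewrite !mxE !eqxx mulr1.
by move=> j ji; rewrite !mxE (negbTE ji) andbF mulr0.
Qed.

Lemma invmx11 (M : 'M[R]_1) : invmx M = ((M 0 0)^-1)%:M.
Proof. by rewrite {1}(mx11_scalar M) invmx_scalar. Qed.

(** Hadamard's inequality by induction on the size: the Schur complement of the leading entry is
    again positive definite, and its diagonal entries are those of [M] minus a square divided by
    [M 0 0]. *)
Lemma pd_det_hadamard n (M : 'M[R]_n) : pd M -> 0 < \det M <= \prod_i M i i.
Proof.
elim: n M => [M _|n IH M' pM]; first by rewrite det_mx00 big_ord0 ltr01 lexx.
pose M : 'M[R]_(1 + n) := M'.
have a0 : 0 < M 0 0 by exact: pd_diag.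
have aE : ulsubmx M 0 0 = M 0 0 by rewrite !mxE; congr (M _ _); apply: val_inj.
have uA : ulsubmx M \in unitmx by rewrite unitmxE det_mx11 aE unitfE gt_eqF.
have /andP[d0 dle] := IH _ (pd_schur uA pM).
have dE : \det M' = M 0 0 * \det (schur M) by rewrite (det_schur uA) det_mx11 aE.
rewrite dE mulr_gt0//= big_ord_recl.
apply: ler_pM => //; first exact: ltW; first exact: ltW.
apply: le_trans dle _; apply: ler_prod => i _; apply/andP; split.
  exact/ltW/pd_diag/pd_schur.
rewrite /schur invmx11 aE mul_mx_scalar -scalemxAl.
have [_ _ <- _] := @sym_blocks 1 n M pM.1.
rewrite [X in X <= _]mxE [X in _ + X <= _]mxE [X in _ - X <= _]mxE.
have -> : M' (lift ord0 i) (lift ord0 i) = M (rshift 1 i) (rshift 1 i).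
  by congr (M' _ _); apply: val_inj.
rewrite [X in X - _]mxE [X in X - _]mxE gerDl oppr_le0 mulr_ge0 ?invr_ge0 ?(ltW a0)//.
by rewrite mxE sumr_ge0// => k _; rewrite !mxE -expr2 sqr_ge0.
Qed.

(** Induction on the size: the leading pivot is at least [c], and the Schur complement has again the
    form [c%:M] plus a positive semidefinite matrix. *)
Lemma psd_det_scalarD n (c : R) (P : 'M[R]_n) : 0 < c -> psd P ->
  c ^+ n <= \det (c%:M + P).
Proof.
move=> c0; elim: n P => [P _|n IH P' pP]; first by rewrite det_mx00.
pose P : 'M[R]_(1 + n) := P'; pose M : 'M[R]_(1 + n) := c%:M + P.
have p0 : 0 <= P 0 0 by exact: psd_diag.
(* With [c] added to the leading entry only, [Q] has the same pivot as [M], so their Schur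
   complements differ exactly by [c%:M]. *)
pose Q : 'M[R]_(1 + n) := block_mx c%:M 0 0 0 + P.
have qP : psd Q.
  apply: (@psdD (1 + n) _ _ _ pP); split; first by rewrite tr_block_mx tr_scalar_mx !trmx0.
  move=> v; rewrite -(hsubmxK v) mul_row_block !mulmx0 !addr0 tr_row_mx mul_row_col.
  by rewrite mul0mx addr0 mul_mx_scalar -scalemxAl mxE mulr_ge0 ?(ltW c0) ?mulmx_tr_ge0.
have ulQ : ulsubmx Q = c%:M + ulsubmx P by rewrite /Q submxD block_mxKul.
have ulM : ulsubmx M = ulsubmx Q.
  by rewrite ulQ /M submxD (@scalar_mx_block _ 1 n) block_mxKul.
have aE : ulsubmx M 0 0 = c + P 0 0.
  by rewrite ulM ulQ !mxE eqxx mulr1n; congr (_ + P _ _); apply: val_inj.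
have a0 : 0 < c + P 0 0 by rewrite ltr_wpDr.
have uA : ulsubmx M \in unitmx by rewrite unitmxE det_mx11 aE unitfE gt_eqF.
have uQ : ulsubmx Q \in unitmx by rewrite -ulM.
have sE : schur M = c%:M + schur Q.
  rewrite /schur ulM /M /Q !submxD (@scalar_mx_block _ 1 n).
  by rewrite !(block_mxKul, block_mxKur, block_mxKdl, block_mxKdr) !add0r addrA.
rewrite -[c%:M + P']/M (det_schur uA) det_mx11 aE sE exprS.
apply: ler_pM; [exact: ltW|exact/exprn_ge0/ltW|by rewrite lerDl|].
exact/IH/psd_schur.
Qed.

(** The Gram matrix of the approximation errors: [G] conjugated by the block row [[1, - A]], written
    out in blocks. *)
Definition residual T N (G : 'M[R]_(T + N)) (A : 'M[R]_(T, N)) : 'M[R]_T :=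
  ulsubmx G - A *m dlsubmx G - ursubmx G *m A^T + A *m drsubmx G *m A^T.

(* [G] is a joint Gram matrix of [T] data points and [N] auxiliary ones, [A]
   holds the coefficients of an approximation of the former by the latter. *)
Lemma det_low_rank T N (G : 'M[R]_(T + N)) (A : 'M[R]_(T, N)) (e : R) :
  0 < e -> psd G ->
  0 < \det (1%:M + ulsubmx G) /\
  \det (1%:M + ulsubmx G) <=
    \prod_i (1 + e * (A *m A^T) i i + residual G A i i) *
    \prod_j (1 + e^-1 * drsubmx G j j).
Proof.
move=> e0 pG.
pose E : 'M[R]_(T + N) := block_mx 1%:M 0 0 (e%:M).
pose J : 'M[R]_(T + N) := E + G.
have pE : pd E.
  split; first by rewrite tr_block_mx !tr_scalar_mx !trmx0.
  move=> v; rewrite -(hsubmxK v); move: (lsubmx v) (rsubmx v) => {}v w vw.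
  rewrite mul_row_block !mulmx0 add0r addr0 tr_row_mx mul_row_col.
  rewrite mulmx1 mul_mx_scalar -scalemxAl mxE [X in _ + X]mxE.
  have [v0|v0] := eqVneq v 0; last first.
    by rewrite ltr_wpDr ?mulmx_tr_gt0// mulr_ge0 ?mulmx_tr_ge0 ?(ltW e0).
  rewrite ltr_wpDl ?mulmx_tr_ge0// mulr_gt0// mulmx_tr_gt0//.
  by apply: contra vw => /eqP ->; rewrite v0 row_mx0.
have pJ : pd J by exact: pdD.
have ulJ : ulsubmx J = 1%:M + ulsubmx G by rewrite /J submxD block_mxKul.
have pul : psd (ulsubmx G).
  split; first by have [] := sym_blocks pG.1.
  move=> v; have := pG.2 (row_mx v 0).
  rewrite -{1}(submxK G) mul_row_block !mul0mx !addr0 tr_row_mx mul_row_col.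
  by rewrite trmx0 mulmx0 addr0.
have pM : pd (ulsubmx J) by rewrite ulJ; apply: pdD pul; exact: pd_scalar.
have /andP[dM _] := pd_det_hadamard pM.
rewrite -ulJ; split=> //.
have uM : ulsubmx J \in unitmx by rewrite unitmxE unitfE gt_eqF.
(* Removing [e] from the auxiliary block of [J] leaves a positive semidefinite matrix with the same
   upper left block. Hence [schur J] is [e%:M] plus a positive semidefinite matrix, and its
   determinant is at least [e ^+ N]. *)
pose Q : 'M[R]_(T + N) := block_mx 1%:M 0 0 0 + G.
have pQ : psd Q.
  apply: psdD pG; split; first by rewrite tr_block_mx tr_scalar_mx !trmx0.
  move=> v; rewrite -(hsubmxK v) mul_row_block !mulmx0 !addr0 tr_row_mx mul_row_col.
  by rewrite mul0mx addr0 mulmx1 mulmx_tr_ge0.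
have ulQ : ulsubmx Q = ulsubmx J by rewrite ulJ /Q submxD block_mxKul.
have sE : schur J = e%:M + schur Q.
  rewrite /schur ulQ /J /Q !submxD.
  by rewrite !(block_mxKul, block_mxKur, block_mxKdl, block_mxKdr) !add0r addrA.
have lowJ : \det (ulsubmx J) * e ^+ N <= \det J.
  rewrite (det_schur uM) ler_pM2l// sE; apply: psd_det_scalarD => //.
  by apply: psd_schur pQ; rewrite ulQ.
(* The shear that subtracts the approximations from the data: it has determinant 1, and conjugation
   by it puts [1 + e |A_i|^2 + Res_ii] on the data part of the diagonal. *)
pose U : 'M[R]_(T + N) := block_mx 1%:M (- A) 0 1%:M.
have dU : \det U = 1 by rewrite det_ublock !det1 mulr1.
have uU : U \in unitmx by rewrite unitmxE dU unitr1.
have /andP[_] := pd_det_hadamard (pd_conj uU pJ).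
rewrite !det_mulmx det_tr dU mul1r mulr1 big_split_ord /=.
have -> : U *m J *m U^T = block_mx (1%:M + e *: (A *m A^T) + residual G A)
   (ursubmx G - e *: A - A *m drsubmx G) (dlsubmx G - e *: A^T - drsubmx G *m A^T)
   (e%:M + drsubmx G).
  rewrite /U /J /E tr_block_mx !trmx1 trmx0 -{1}(submxK G) add_block_mx.
  rewrite linearN /= !mulmx_block !mulmx1 !mul1mx !mulmx0 !mul0mx ?add0r ?addr0.
  rewrite !mulmxDl !mulmxDr !mulNmx !mulmxN ?add0r.
  congr block_mx; rewrite /residual ?mul_mx_scalar ?mul_scalar_mx ?addrA//.
  rewrite mulmxBl mulNmx -scalemxAl.
  move: (A *m A^T) (A *m dlsubmx G) (_ *m A^T) (_ *m A^T) => X1 X2 X3 X4.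
  by apply/matrixP => i j; rewrite !mxE; ring.
under eq_bigr do rewrite block_mxEul; under [X in _ * X]eq_bigr do rewrite block_mxEdr.
(* The lower and upper bounds on [\det J] are compared; the factor [e ^+ N] is shared among the
   auxiliary entries, as [e + G_jj = e (1 + G_jj / e)]. *)
move=> up; rewrite -(ler_pM2r (exprn_gt0 N e0)).
apply: le_trans lowJ (le_trans up _).
rewrite -mulrA le_eqVlt; apply/orP; left; apply/eqP; congr (_ * _).
  by apply: eq_bigr => i _; rewrite !mxE eqxx mulr1n.
rewrite -[X in _ ^+ X]card_ord -prodr_const -big_split /=; apply: eq_bigr => i _.
by rewrite !mxE eqxx mulr1n mulrDl mul1r mulrAC mulVf ?mul1r// gt_eqF.
Qed.

End psd_matrices.

(** * From the determinant inequality to the information gain *)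

Section low_rank_info_gain.
Variable R : realType.

(** This is [det_low_rank] for [c *: G], with [1 + x <= expR x] applied to the data factors and the
    bound 1 on the diagonal to the auxiliary ones. *)
Lemma ln_det_low_rank T N (G : 'M[R]_(T + N)) (A : 'M[R]_(T, N)) (e c : R) :
  0 < e -> 0 < c -> psd G -> (forall j, drsubmx G j j <= 1) ->
  ln (\det (1%:M + c *: ulsubmx G)) <=
    N%:R * ln (1 + c / e) + \sum_i (e * (A *m A^T) i i + c * residual G A i i).
Proof.
move=> e0 c0 pG dG; set Res := residual G A.
have ulZ : ulsubmx (c *: G) = c *: ulsubmx G by apply/matrixP => i j; rewrite !mxE.
have urZ : ursubmx (c *: G) = c *: ursubmx G by apply/matrixP => i j; rewrite !mxE.
have dlZ : dlsubmx (c *: G) = c *: dlsubmx G by apply/matrixP => i j; rewrite !mxE.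
have drZ : drsubmx (c *: G) = c *: drsubmx G by apply/matrixP => i j; rewrite !mxE.
have pRes : psd Res.
  have -> : Res = row_mx 1%:M (- A) *m G *m (row_mx 1%:M (- A))^T.
    rewrite -{1}(submxK G) mul_row_block tr_row_mx mul_row_col.
    rewrite trmx1 mulmx1 !mul1mx /Res /residual linearN /= !mulNmx mulmxN mulmxBl.
    by rewrite opprB !addrA [RHS]addrAC.
  exact: psd_conj.
have [] := det_low_rank A e0 (psdZ (ltW c0) pG); rewrite /residual ulZ urZ dlZ drZ.
rewrite -!scalemxAl -!scalemxAr -!scalerBr -scalemxAl -scalerDr -/(residual G A) -/Res => d0 dle.
have pos1 i : 0 < 1 + e * (A *m A^T) i i + (c *: Res) i i.
  rewrite -addrA ltr_wpDr// addr_ge0// ?mulr_ge0 ?(ltW e0)//.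
    by rewrite mxE sumr_ge0// => j _; rewrite !mxE -expr2 sqr_ge0.
  by rewrite mxE mulr_ge0 ?(ltW c0)// psd_diag.
have dr0 j : 0 <= drsubmx G j j.
  by have := psd_diag (rshift T j) pG; rewrite !mxE.
have pos2 j : 0 < 1 + e^-1 * (c *: drsubmx G) j j.
  rewrite ltr_wpDr// mulr_ge0 ?invr_ge0 ?(ltW e0)//.
  by rewrite mxE mulr_ge0 ?(ltW c0).
apply: (@le_trans _ _ (ln (expR (\sum_i (e * (A *m A^T) i i + c * Res i i)) *
   (1 + c / e) ^+ N))).
  rewrite ler_ln ?posrE//; last first.
    by rewrite mulr_gt0 ?expR_gt0 ?exprn_gt0// ltr_wpDr// divr_ge0 ?ltW.
  apply: le_trans dle _; apply: ler_pM.
  - by apply: prodr_ge0 => i _; exact: ltW.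
  - by apply: prodr_ge0 => i _; exact: ltW.
  - rewrite expR_sum; apply: ler_prod => i _; rewrite (ltW (pos1 i))/=.
    rewrite -addrA; apply: le_trans (expR_ge1Dx _) _.
    by rewrite [X in _ + X]mxE.
  - rewrite -[X in _ ^+ X]card_ord -prodr_const; apply: ler_prod => j _.
    rewrite (ltW (pos2 j))/= lerD2l mulrC ler_wpM2r ?invr_ge0 ?(ltW e0)//.
    by rewrite mxE ger_pMr.
have q0 : 0 < 1 + c / e by rewrite ltr_wpDr// divr_ge0 ?ltW.
by rewrite lnM ?posrE ?expR_gt0 ?exprn_gt0// expRK lnXn// addrC mulr_natl.
Qed.

(** The auxiliary vectors are indexed by any finite type and enter only through their inner
    products: [kx] with the data, [ke] among themselves. The quadratic hypothesis says that the
    joint Gram matrix is positive semidefinite. This form serves both abstract features and kernel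
    sections at nodes. *)
Lemma ln_det_features d T (k : 'rV[R]_d -> 'rV[R]_d -> R) (X : 'I_T -> 'rV[R]_d)
    (E : finType) (kx : 'I_T -> E -> R) (ke : E -> E -> R) (a : 'I_T -> E -> R)
    (e c B r : R) :
  0 < e -> 0 < c ->
  (forall i j, k (X i) (X j) = k (X j) (X i)) -> (forall p q, ke p q = ke q p) ->
  (forall (u : 'I_T -> R) (w : E -> R),
     0 <= \sum_i \sum_j u i * u j * k (X i) (X j) +
          2 * (\sum_i \sum_p u i * w p * kx i p) +
          \sum_p \sum_q w p * w q * ke p q) ->
  (forall p, ke p p <= 1) ->
  (forall i, \sum_p a i p ^+ 2 <= B) ->
  (forall i, k (X i) (X i) - 2 * (\sum_p a i p * kx i p)
             + \sum_p \sum_q a i p * a i q * ke p q <= r) ->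
  ln (\det (1%:M + c *: gram k X)) <=
    #|E|%:R * ln (1 + c / e) + T%:R * (e * B + c * r).
Proof.
move=> e0 c0 ksym kesym jpsd ke1 aB ar.
pose G : 'M[R]_(T + #|E|) := block_mx (gram k X) (\matrix_(i, j) kx i (enum_val j))
  (\matrix_(i, j) kx j (enum_val i)) (\matrix_(i, j) ke (enum_val i) (enum_val j)).
pose A : 'M[R]_(T, #|E|) := \matrix_(i, j) a i (enum_val j).
have reE (F : E -> R) : \sum_(j < #|E|) F (enum_val j) = \sum_p F p.
  by rewrite -(big_enum_val F); apply: eq_bigl => p; rewrite inE.
have pG : psd G.
  split.
    rewrite tr_block_mx; congr block_mx; apply/matrixP => i j; rewrite !mxE//.
  move=> v; rewrite -(hsubmxK v); move: (lsubmx v) (rsubmx v) => {}v w.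
  rewrite mul_row_block tr_row_mx mul_row_col.
  have := jpsd (fun i => v 0 i) (fun p => w 0 (enum_rank p)).
  congr (0 <= _); rewrite !mulmxDl mxE [in RHS]mxE [X in _ = _ + X]mxE.
  rewrite mulr2n mulrDl mul1r -!addrA; congr (_ + _).
    by rewrite mxE exchange_big/=; apply: eq_bigr => i _; rewrite !mxE mulr_suml;
      apply: eq_bigr => j _; rewrite !mxE; ring.
  rewrite [RHS]addrCA; congr (_ + _).
    rewrite mxE exchange_big/= -reE; apply: eq_bigr => j _.
    by rewrite !mxE mulr_suml; apply: eq_bigr => i _; rewrite !mxE enum_valK; ring.
  congr (_ + _).
    rewrite mxE; apply: eq_bigr => i _.
    rewrite !mxE -reE mulr_suml.
    by apply: eq_bigr => j _; rewrite !mxE enum_valK; ring.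
  rewrite mxE exchange_big -reE/=; apply: eq_bigr => i _; rewrite !mxE mulr_suml -reE.
  by apply: eq_bigr => j _; rewrite !mxE !enum_valK; ring.
have := @ln_det_low_rank T #|E| G A e c e0 c0 pG.
rewrite /residual /G block_mxKul block_mxKur block_mxKdl block_mxKdr.
move=> /(_ _)/le_trans; apply; first by move=> j; rewrite mxE.
rewrite lerD2l mulr_natl -[X in _ *+ X]card_ord -sumr_const; apply: ler_sum => i _.
apply: lerD; rewrite ler_pM2l//.
  rewrite mxE -[leRHS]mulr1 ; apply: le_trans (_ : B <= _); last by rewrite mulr1.
  apply: le_trans (aB i); rewrite -reE le_eqVlt; apply/orP; left; apply/eqP.
  by apply: eq_bigr => j _; rewrite !mxE expr2.
apply: le_trans (ar i); rewrite le_eqVlt; apply/orP; left; apply/eqP.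
rewrite mxE; congr (_ + _).
  rewrite mxE [X in X + _ = _]mxE [X in _ + X = _]mxE [X in _ + X - _ = _]mxE.
  rewrite mulr2n mulrDl mul1r opprD addrA mxE.
  congr (_ - _ - _); rewrite ?mxE -reE.
    by apply: eq_bigr => j _; rewrite !mxE.
  by apply: eq_bigr => j _; rewrite !mxE mulrC.
rewrite mxE exchange_big -reE/=; apply: eq_bigr => j _; rewrite !mxE mulr_suml -reE.
by apply: eq_bigr => l _; rewrite !mxE; ring.
Qed.

Lemma info_gain_le d T (k : 'rV[R]_d -> 'rV[R]_d -> R) (lambda b : R) :
  (forall X : 'I_T -> 'rV[R]_d, (forall i, enorm (X i) <= 1) ->
    2^-1 * ln (\det (1%:M + lambda ^-2 *: gram k X)) <= b) ->
  info_gain T k lambda <= b.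
Proof.
move=> h; apply: ge_sup; last by move=> v /= [X [X1 ->]]; exact: h.
(* An upper bound of a set bounds its [sup] only when the set is nonempty; the origin repeated [T]
   times is an admissible configuration. *)
eexists; exists (fun=> 0); split; last reflexivity.
move=> _; rewrite /enorm big1 ?sqrtr0// => i _.
by rewrite mxE expr0n.
Qed.

End low_rank_info_gain.

(** * Taylor features of the Gaussian kernel *)

Section gaussian_features.
Variable R : realType.
Local Open Scope classical_set_scope.

Lemma cvg_exp_series (x : R) :
  (fun M => \sum_(n < M) x ^+ n / n`!%:R) @ \oo --> expR x.
Proof.
have := is_cvg_series_exp_coeff x; rewrite -/(expR x) => h.
rewrite (_ : (fun M => _) = series (exp_coeff x))//.
by apply/funext => M; rewrite /series/= big_mkord.
Qed.

Lemma exp_series_le (x : R) M : 0 <= x -> \sum_(n < M) x ^+ n / n`!%:R <= expR x.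
Proof.
move=> x0; apply: (cvgr_to_ge (@cvg_exp_series x)).
near=> N; rewrite (big_ord_widen N (fun n => x ^+ n / n`!%:R)); last first.
  by near: N; exact: nbhs_infty_ge.
rewrite [leRHS](bigID (fun n : 'I_N => (n < M)%N))/= lerDl.
by apply: sumr_ge0 => i _; rewrite divr_ge0 ?exprn_ge0.
Unshelve. all: by end_near. Qed.

Lemma exp_term_le (x : R) n : 0 <= x -> x ^+ n / n`!%:R <= expR x.
Proof.
move=> x0; apply: le_trans (exp_series_le n.+1 x0); rewrite big_ord_recr/= lerDr.
by apply: sumr_ge0 => i _; rewrite divr_ge0 ?exprn_ge0.
Qed.

(** Since [D! i! <= (D + i)!], the tail from rank [D] is at most [|x|^D / D!] times a partial sum of
    the exponential series at [|x|]. *)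
Lemma exp_taylor (x : R) D :
  `|expR x - \sum_(n < D) x ^+ n / n`!%:R| <= expR `|x| * (`|x| ^+ D / D`!%:R).
Proof.
have h : (fun M => `|\sum_(n < M) x ^+ n / n`!%:R - \sum_(n < D) x ^+ n / n`!%:R|)
    @ \oo --> `|expR x - \sum_(n < D) x ^+ n / n`!%:R|.
  by apply: cvg_norm; apply: cvgB; [exact: cvg_exp_series|exact: cvg_cst].
apply: (cvgr_to_le h); near=> N; have DN : (D <= N)%N by near: N; exact: nbhs_infty_ge.
rewrite -(subnKC DN) big_split_ord/= addrAC subrr add0r.
apply: le_trans (ler_norm_sum _ _ _) _.
apply: (@le_trans _ _ ((\sum_(i < N - D) `|x| ^+ i / i`!%:R) * (`|x| ^+ D / D`!%:R))).
  rewrite mulr_suml; apply: ler_sum => i _.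
  rewrite normrM normrX normfV (ger0_norm (ler0n _ _)) exprD.
  rewrite [leRHS]mulrACA [X in X * _]mulrC; apply: ler_wpM2l.
    by rewrite mulr_ge0 ?exprn_ge0.
  rewrite -invfM lef_pV2 ?posrE ?mulr_gt0 ?ltr0n ?fact_gt0//.
  rewrite -natrM ler_nat -(bin_fact (leq_addr i D)) addKn.
  by rewrite [leqLHS]mulnC leq_pmull// bin_gt0 leq_addr.
by apply: ler_wpM2r; rewrite ?divr_ge0 ?exprn_ge0// exp_series_le.
Unshelve. all: by end_near. Qed.

Definition gauss (rho : R) d (x y : 'rV[R]_d) : R :=
  expR (- (rho * \sum_i (x 0 i - y 0 i) ^+ 2)).

(** In dimension one, [exp (- rho (x - y)^2)] is [exp (- rho x^2) exp (- rho y^2) exp (2 rho x y)];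
    the n-th term of the expansion of the last factor splits as a product of this feature at [x] and
    at [y]. *)
Definition feat1 (rho : R) n (x : R) : R :=
  Num.sqrt ((2 * rho) ^+ n / n`!%:R) * x ^+ n * expR (- (rho * x ^+ 2)).

Definition feat (rho : R) d D (e : {ffun 'I_d -> 'I_D}) (x : 'rV[R]_d) : R :=
  \prod_i feat1 rho (e i) (x 0 i).

(** The truncation is made in each coordinate separately, so the surviving multi-indices form a cube
    with [D ^ d] elements. *)
Definition trunc_gauss (rho : R) d D (x y : 'rV[R]_d) : R :=
  \prod_i \sum_(n < D) feat1 rho n (x 0 i) * feat1 rho n (y 0 i).

Lemma feat1M rho n x y : 0 <= rho -> feat1 rho n x * feat1 rho n y =
  (2 * rho * x * y) ^+ n / n`!%:R * expR (- (rho * (x ^+ 2 + y ^+ 2))).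
Proof.
move=> r0; rewrite /feat1 mulrDr opprD expRD.
rewrite (_ : forall a b c d e : R, a * b * c * (a * d * e) = a ^+ 2 * (b * d) * (c * e)).
  by rewrite sqr_sqrtr ?divr_ge0 ?exprn_ge0 ?mulr_ge0// !exprMn; ring.
by move=> *; ring.
Qed.

Lemma trunc_gauss_feat rho d D M (x y : 'rV[R]_d) : (D <= M)%N ->
  trunc_gauss rho D x y =
  \sum_(e : {ffun 'I_d -> 'I_M} | [forall i, e i < D]%N) feat rho e x * feat rho e y.
Proof.
move=> DM; rewrite /trunc_gauss.
under eq_bigr => i _ do
  rewrite (big_ord_widen M (fun n => feat1 rho n (x 0 i) * feat1 rho n (y 0 i)) DM).
rewrite (bigA_distr_big _ (fun i (j : 'I_M) => feat1 rho j (x 0 i) * feat1 rho j (y 0 i))).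
apply: eq_big => [e|e _]; last by rewrite -big_split.
by apply/ffun_onP/forallP.
Qed.

Lemma gauss_cvg rho d (x y : 'rV[R]_d) : 0 <= rho ->
  (fun M => trunc_gauss rho M x y) @ \oo --> gauss rho x y.
Proof.
move=> r0; rewrite /gauss mulr_sumr -sumrN expR_sum.
apply: cvg_big => [|i _]; first exact: mul_continuous.
under eq_fun do under eq_bigr do rewrite feat1M//.
under eq_fun do rewrite -mulr_suml.
rewrite (_ : expR _ = expR (2 * rho * x 0 i * y 0 i) *
   expR (- (rho * (x 0 i ^+ 2 + y 0 i ^+ 2)))).
  by apply: cvgM; [exact: cvg_exp_series|exact: cvg_cst].
by rewrite -expRD; congr expR; ring.
Qed.

(** For a finite level [M >= D], the difference of the two truncations is a sum of squares over the
    multi-indices outside the cube of side [D]; then [M] tends to infinity. *)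
Lemma trunc_gauss_psd rho d D (I : finType) (u : I -> R) (X : I -> 'rV[R]_d) :
  0 <= rho ->
  0 <= \sum_i \sum_j u i * u j * (gauss rho (X i) (X j) - trunc_gauss rho D (X i) (X j)).
Proof.
move=> r0; have h : (fun M => \sum_i \sum_j u i * u j *
      (trunc_gauss rho M (X i) (X j) - trunc_gauss rho D (X i) (X j))) @ \oo -->
    \sum_i \sum_j u i * u j * (gauss rho (X i) (X j) - trunc_gauss rho D (X i) (X j)).
  apply: cvg_big => [|i _]; first exact: add_continuous.
  apply: cvg_big => [|j _]; first exact: add_continuous.
  apply: cvgM; first exact: cvg_cst.
  by apply: cvgB; [exact: gauss_cvg|exact: cvg_cst].
apply: (cvgr_to_ge h); near=> M; have DM : (D <= M)%N by near: M; exact: nbhs_infty_ge.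
rewrite (_ : \sum_i _ = \sum_(e : {ffun 'I_d -> 'I_M} | ~~ [forall i, e i < D]%N)
    (\sum_i u i * feat rho e (X i)) ^+ 2).
  by apply: sumr_ge0 => e _; exact: sqr_ge0.
under [RHS]eq_bigr do rewrite expr2 mulr_suml.
rewrite [RHS]exchange_big/=; apply: eq_bigr => i _.
under [RHS]eq_bigr do rewrite mulr_sumr.
rewrite [RHS]exchange_big/=; apply: eq_bigr => j _.
rewrite (trunc_gauss_feat _ _ _ DM) (trunc_gauss_feat _ _ _ (leqnn M)).
rewrite [X in X - _](eq_bigl xpredT); last first.
  by move=> e /=; apply/idP/forallP => // _ k; exact: ltn_ord.
rewrite (bigID (fun e : {ffun 'I_d -> 'I_M} => [forall i, e i < D]%N))/= addrAC subrr add0r.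
by rewrite mulr_sumr; apply: eq_bigr => e _; ring.
Unshelve. all: by end_near. Qed.

Lemma gauss_psd rho d (I : finType) (u : I -> R) (X : I -> 'rV[R]_d) :
  (0 < d)%N -> 0 <= rho -> 0 <= \sum_i \sum_j u i * u j * gauss rho (X i) (X j).
Proof.
(* For [D = 0] the truncated kernel has an empty sum as a factor, and is zero because [d] is
   positive. *)
move=> d0 r0; have := trunc_gauss_psd 0 u X r0; congr (0 <= _).
apply: eq_bigr => i _; apply: eq_bigr => j _.
by rewrite /trunc_gauss (bigD1 (Ordinal d0))//= big_ord0 mul0r subr0.
Qed.

Lemma gaussxx rho d (x : 'rV[R]_d) : gauss rho x x = 1.
Proof.
rewrite /gauss big1 ?mulr0 ?oppr0 ?expR0// => i _.
by rewrite subrr expr0n.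
Qed.

Lemma gaussC rho d (x y : 'rV[R]_d) : gauss rho x y = gauss rho y x.
Proof.
by rewrite /gauss; do 3 f_equal; apply: eq_bigr => i _; rewrite -sqrrN opprB.
Qed.

Lemma prod_1B_ge (I : finType) (q : I -> R) : (forall i, 0 <= q i <= 1) ->
  1 - \prod_i q i <= \sum_i (1 - q i).
Proof.
move=> q01; suff : 0 <= \prod_i q i <= 1 /\ 1 - \prod_i q i <= \sum_i (1 - q i) by case.
elim/big_ind2: _ => [|s p s' p' [/andP[p0 p1] h] [/andP[p0' p1'] h']|i _].
- by rewrite subrr ler01 !lexx.
- rewrite mulr_ge0// mulr_ile1//; split=> //.
  have : 0 <= (1 - p) * (1 - p') by apply: mulr_ge0; rewrite subr_ge0.
  lra.
- by rewrite q01.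
Qed.

(** On the diagonal, each coordinate contributes the probability that a Poisson variable of mean
    [2 rho x_i^2] is less than [D]. The defect of the product is at most the sum of the defects, and
    each of these is an exponential tail. *)
Lemma trunc_gauss_diag rho d D (x : 'rV[R]_d) : 0 <= rho ->
  (forall i, `|x 0 i| <= 1) ->
  trunc_gauss rho D x x <= 1 /\
  1 - trunc_gauss rho D x x <= d%:R * ((2 * rho) ^+ D / D`!%:R).
Proof.
move=> r0 x1.
pose q (i : 'I_d) := \sum_(n < D) feat1 rho n (x 0 i) * feat1 rho n (x 0 i).
have qE i : q i = (\sum_(n < D) (2 * rho * x 0 i ^+ 2) ^+ n / n`!%:R) *
     expR (- (2 * rho * x 0 i ^+ 2)).
  rewrite mulr_suml; apply: eq_bigr => n _; rewrite feat1M//.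
  by congr (_ ^+ _ / _ * expR _); ring.
have a0 i : 0 <= 2 * rho * x 0 i ^+ 2 by rewrite mulr_ge0 ?sqr_ge0 ?mulr_ge0.
have q01 i : 0 <= q i <= 1.
  apply/andP; split; first by apply: sumr_ge0 => n _; rewrite -expr2 sqr_ge0.
  by rewrite qE expRN ler_pdivrMr ?expR_gt0// mul1r exp_series_le.
split; first by apply: prodr_ile1 => i _; exact: q01.
apply: (le_trans (prod_1B_ge q01)).
rewrite mulr_natl -[X in _ *+ X]card_ord -sumr_const; apply: ler_sum => i _.
have := exp_taylor (2 * rho * x 0 i ^+ 2) D; rewrite (ger0_norm (a0 i)).
move=> /(le_trans (ler_norm _)).
rewrite qE => h; rewrite -(@ler_pM2l _ (expR (2 * rho * x 0 i ^+ 2))) ?expR_gt0//.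
rewrite mulrBr mulr1 [expR _ * (_ * _)]mulrCA -expRD subrr expR0 mulr1.
apply: (le_trans h); rewrite ler_pM2l ?expR_gt0//.
apply: ler_wpM2r; first by rewrite invr_ge0.
apply: lerXn2r; rewrite ?nnegrE ?a0 ?mulr_ge0//.
by rewrite ler_piMr ?mulr_ge0// -real_normK ?num_real// expr_le1.
Qed.

End gaussian_features.

(** * Squared exponential kernel *)

Section squared_exponential.
Variable R : realType.

Lemma enorm_sqr d (x : 'rV[R]_d) : enorm x ^+ 2 = \sum_i x 0 i ^+ 2.
Proof. by rewrite sqr_sqrtr// sumr_ge0// => i _; exact: sqr_ge0. Qed.

Lemma enorm_coord d (x : 'rV[R]_d) i : enorm x <= 1 -> `|x 0 i| <= 1.
Proof.
move=> x1; rewrite -(@ler_pXn2r _ 2) ?nnegrE// real_normK ?num_real// expr1n.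
apply: (@le_trans _ _ (enorm x ^+ 2)); last by rewrite expr_le1// sqrtr_ge0.
rewrite enorm_sqr (bigD1 i)//= lerDl sumr_ge0// => j _; exact: sqr_ge0.
Qed.

Lemma k_SE_gauss l d (x y : 'rV[R]_d) :
  k_SE l x y = gauss (2 * l ^+ 2)^-1 x y.
Proof.
rewrite /k_SE /gauss enorm_sqr mulrC; congr (expR (- (_ * _))).
by apply: eq_bigr => i _; rewrite !mxE.
Qed.

(** The features act as orthonormal auxiliary vectors: [ke] is the identity, and the coefficients of
    a data point are its feature values. Their squares sum to at most 1, so [e = 1 / T] costs 1 in
    total, and the residual is the diagonal defect of the truncation. *)
Lemma gauss_ln_det rho d T D (c : R) (X : 'I_T -> 'rV[R]_d) :
  0 <= rho -> 0 < c -> (0 < T)%N -> (forall i, enorm (X i) <= 1) ->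
  ln (\det (1%:M + c *: gram (@gauss R rho d) X)) <=
    (D ^ d)%:R * ln (1 + c * T%:R) + 1 + c * T%:R * (d%:R * ((2 * rho) ^+ D / D`!%:R)).
Proof.
move=> r0 c0 T0 X1.
have tp : 0 < T%:R :> R by rewrite ltr0n.
have trE x y : trunc_gauss rho D x y =
    \sum_(p : {ffun 'I_d -> 'I_D}) feat rho p x * feat rho p y.
  rewrite (trunc_gauss_feat _ _ _ (leqnn D)); apply: eq_bigl => p.
  by apply/idP/forallP => // _ k; exact: ltn_ord.
have trE2 x : trunc_gauss rho D x x =
    \sum_(p : {ffun 'I_d -> 'I_D}) feat rho p x ^+ 2.
  by rewrite trE; apply: eq_bigr => p _; rewrite expr2.
have deltaE (F : {ffun 'I_d -> 'I_D} -> {ffun 'I_d -> 'I_D} -> R) :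
    \sum_p \sum_q F p q * (p == q)%:R = \sum_p F p p.
  apply: eq_bigr => p _; rewrite (bigD1 p)//= eqxx mulr1 big1 ?addr0//.
  by move=> q /negbTE; rewrite eq_sym => ->; rewrite mulr0.
have := @ln_det_features R d T (@gauss R rho d) X {ffun 'I_d -> 'I_D}
  (fun i p => feat rho p (X i)) (fun p q => (p == q)%:R)
  (fun i p => feat rho p (X i)) (T%:R^-1) c 1 (d%:R * ((2 * rho) ^+ D / D`!%:R)).
rewrite invr_gt0 invrK => /(_ tp c0) H; apply: le_trans (H _ _ _ _ _ _) _.
- by move=> i j; exact: gaussC.
- by move=> p q; rewrite eq_sym.
- move=> u w; rewrite deltaE.
  have h1 : 0 <= \sum_(p : {ffun 'I_d -> 'I_D}) (w p + \sum_i u i * feat rho p (X i)) ^+ 2.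
    by apply: sumr_ge0 => p _; exact: sqr_ge0.
  have h2 := trunc_gauss_psd D u X r0.
  (* Completing the square in [w] leaves the quadratic form of the truncation remainder. *)
  rewrite (_ : _ + _ + _ =
    \sum_(p : {ffun 'I_d -> 'I_D}) (w p + \sum_i u i * feat rho p (X i)) ^+ 2 +
    \sum_i \sum_j u i * u j *
      (gauss rho (X i) (X j) - trunc_gauss rho D (X i) (X j))); first exact: addr_ge0.
  have -> : \sum_i \sum_j u i * u j *
      (gauss rho (X i) (X j) - trunc_gauss rho D (X i) (X j)) =
      \sum_i \sum_j u i * u j * gauss rho (X i) (X j) -
      \sum_(p : {ffun 'I_d -> 'I_D}) (\sum_i u i * feat rho p (X i)) ^+ 2.
    under [X in _ = _ - X]eq_bigr do rewrite expr2 mulr_suml.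
    rewrite [X in _ = _ - X]exchange_big/= -sumrB; apply: eq_bigr => i _.
    under [X in _ = _ - X]eq_bigr do rewrite mulr_sumr.
    rewrite [X in _ = _ - X]exchange_big/= -sumrB; apply: eq_bigr => j _.
    rewrite mulrBr; congr (_ - _); rewrite trE mulr_sumr.
    by apply: eq_bigr => p _; ring.
  rewrite (_ : \sum_(p : {ffun 'I_d -> 'I_D}) (w p + _) ^+ 2 =
     \sum_p w p * w p + 2 * (\sum_i \sum_p u i * w p * feat rho p (X i))
     + \sum_(p : {ffun 'I_d -> 'I_D}) (\sum_i u i * feat rho p (X i)) ^+ 2); first by ring.
  rewrite exchange_big/= mulr_sumr -!big_split/=; apply: eq_bigr => p _.
  rewrite (_ : \sum_i u i * w p * feat rho p (X i) = w p * \sum_i u i * feat rho p (X i)).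
    by ring.
  by rewrite mulr_sumr; apply: eq_bigr => i _; ring.
- by move=> p; rewrite eqxx.
- by move=> i; rewrite -trE2; apply: (trunc_gauss_diag D r0 _).1 => j; exact: enorm_coord.
- move=> i; rewrite deltaE gaussxx.
  rewrite -!trE; apply: le_trans ((trunc_gauss_diag D r0 _).2); last first.
    by move=> j; apply: enorm_coord; exact: X1.
  by move: (trunc_gauss _ _ _ _) => t; lra.
- rewrite card_ffun !card_ord -addrA lerD2l mulr1 mulrDr mulfV ?gt_eqF//.
  by rewrite lerD2l mulrA [T%:R * c]mulrC.
Qed.

Lemma info_gain_SE d T (lambda l : R) (D : nat) : 0 < lambda -> 0 < l -> (0 < T)%N ->
  let theta := 2 * l ^+ 2 in
  (T%:R / lambda ^+ 2 * ((2 / theta) ^+ D / D`!%:R) <= 1)%R ->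
  (info_gain T (@k_SE R l d) lambda <=
    D%:R ^+ d * ln (1 + T%:R / lambda ^+ 2) + (1 + d%:R))%R.
Proof.
move=> l0 ll0 T0 theta hD; apply: info_gain_le => X X1.
have -> : gram (@k_SE R l d) X = gram (@gauss R theta^-1 d) X.
  by apply/matrixP => i j; rewrite !mxE k_SE_gauss.
have c0 : 0 < lambda ^- 2 by rewrite invr_gt0 exprn_gt0.
have th0 : 0 <= theta^-1 by rewrite invr_ge0 mulr_ge0 ?sqr_ge0.
have Lg : 0 <= ln (1 + T%:R / lambda ^+ 2).
  by rewrite ln_ge0// lerDl divr_ge0 ?sqr_ge0.
have := gauss_ln_det D th0 c0 T0 X1; rewrite [lambda ^- 2 * _]mulrC natrX.
set A := D%:R ^+ d * _.
have A0 : 0 <= A by rewrite mulr_ge0 ?exprn_ge0.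
have : T%:R / lambda ^+ 2 * (d%:R * ((2 / theta) ^+ D / D`!%:R)) <= d%:R.
  by rewrite mulrCA ler_piMr.
have : 0 <= d%:R :> R by [].
set Q := ln _; set W := _ * (_ * _); lra.
Qed.

Lemma ceil_nat (x : R) : 0 <= x -> exists2 n : nat, x <= n%:R & n%:R <= x + 1.
Proof.
move=> x0; exists (Num.truncn x).+1; first exact/ltW/truncnS_gt.
by rewrite -natr1 lerD2r truncn_le.
Qed.

Lemma mulr_expRN_ln_le1 (s : R) : 0 < s -> s * expR (- ln (1 + s)) <= 1.
Proof.
move=> s0; have h : 0 < 1 + s by rewrite addr_gt0.
by rewrite expRN lnK ?posrE// ler_pdivrMr// mul1r lerDr.
Qed.

Lemma expn_addr1_le (x : R) n : 0 <= x -> (x + 1) ^+ n <= 2 ^+ n * (x ^+ n + 1).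
Proof.
move=> x0; have [x1|x1] := leP x 1.
  apply: (@le_trans _ _ (2 ^+ n)); first by rewrite lerXn2r ?nnegrE//; lra.
  by rewrite ler_peMr ?exprn_ge0// lerDr exprn_ge0.
apply: (@le_trans _ _ ((2 * x) ^+ n)); first by rewrite lerXn2r ?nnegrE//; lra.
by rewrite exprMn ler_wpM2l ?exprn_ge0// lerDl.
Qed.

(** Take [D] to be about [L + 2 e^2 / theta]. Then [2 / theta <= D e^-2] and [D^D / D! <= e^D] give
    [(2 / theta)^D / D! <= e^-D <= e^-L], which meets the condition of [info_gain_SE]. *)
Lemma info_gain_SE_small d : exists2 C : R, 0 < C &
  forall (cd lambda l : R) (T : nat), 0 < lambda -> (0 < T)%N -> 0 < l -> 1 <= cd ->
  let theta := 2 * l ^+ 2 in let L := ln (1 + T%:R / lambda ^+ 2) in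
  theta <= expR 1 ^+ 2 * cd -> lambda ^+ 2 <= T%:R / (expR 1 - 1) ->
  (info_gain T (@k_SE R l d) lambda <=
     (C * cd ^+ d) / theta ^+ d * L ^+ d.+1 + (1 + d%:R))%R.
Proof.
exists ((4 * expR 1 ^+ 2) ^+ d); first by rewrite exprn_gt0// mulr_gt0// exprn_gt0// expR_gt0.
move=> cd lambda l T l0 T0 ll0 cd1 theta L th hT.
set e2 := expR 1 ^+ 2 in th *.
have e1 : 1 < expR 1 :> R by rewrite expR_gt1.
have e21 : 1 <= e2 by rewrite exprn_ege1// ltW.
have th0 : 0 < theta by rewrite mulr_gt0 ?exprn_gt0.
have tl0 : 0 < T%:R / lambda ^+ 2 by rewrite divr_gt0 ?exprn_gt0 ?ltr0n.
(* This is where the lower bound on [T] enters; [1 <= L] lets every term of the bound on [D] be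
   absorbed into a multiple of [L / theta]. *)
have L1 : 1 <= L.
  rewrite -[leLHS]expRK ler_ln ?posrE ?expR_gt0 ?addr_gt0//.
  rewrite -lerBlDl ler_pdivlMr ?exprn_gt0//.
  by move: hT; rewrite ler_pdivlMr ?subr_gt0// mulrC.
have L0 : 0 <= L by lra.
have q0 : 0 <= 2 * e2 / theta by rewrite divr_ge0 ?(ltW th0)//; lra.
have [D D1 D2] := ceil_nat (addr_ge0 L0 q0).
have := @info_gain_SE d T lambda l D l0 ll0 T0; rewrite -/theta => /(_ _)/le_trans; apply.
  have hr : (2 / theta) ^+ D / D`!%:R <= expR (- L).
    apply: (@le_trans _ _ (expR (- D%:R))); last by rewrite ler_expR; lra.
    have : 2 / theta <= D%:R * expR (- 1) ^+ 2.
      rewrite expRN exprVn -/e2 ler_pdivlMr; last by lra.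
      by rewrite mulrAC; lra.
    move=> h; apply: (@le_trans _ _ ((D%:R * expR (- 1) ^+ 2) ^+ D / D`!%:R)).
      rewrite ler_wpM2r ?invr_ge0// lerXn2r ?nnegrE ?divr_ge0 ?(ltW th0)//.
    rewrite exprMn mulrAC.
    apply: le_trans (ler_wpM2r _ (exp_term_le D (ler0n R D))) _.
      by rewrite !exprn_ge0 ?expR_ge0.
    rewrite -!expRM_natl -expRD ler_expR.
    by lra.
  apply: le_trans (mulr_expRN_ln_le1 tl0); apply: ler_wpM2l hr; exact: ltW.
rewrite lerD2r (exprSr L) [leRHS]mulrA; apply: ler_wpM2r => //.
have aux (a b c t : R) : (4 * a) ^+ d * b ^+ d / t ^+ d * c ^+ d = (4 * a * b * c / t) ^+ d.
  by rewrite !exprMn exprVn [RHS]mulrAC.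
rewrite aux.
(* The 4 counts one share of [e2 * cd * L] for [L * theta], two for [2 * e2], and one for
   [theta]. *)
have key : D%:R <= 4 * e2 * cd * L / theta.
  apply: (le_trans D2); rewrite ler_pdivlMr//.
  have -> : (L + 2 * e2 / theta + 1) * theta = L * theta + 2 * e2 + theta.
    by move: (theta) th0 => t t0; field; rewrite gt_eqF.
  have Z1 : e2 <= e2 * cd by rewrite ler_peMr//; lra.
  have h1 : L * theta <= e2 * cd * L by rewrite mulrC ler_wpM2r.
  have h3 : e2 * cd <= e2 * cd * L by rewrite ler_peMr//; lra.
  rewrite (_ : 4 * e2 * cd * L = 4 * (e2 * cd * L)); last by rewrite !mulrA.
  by move: (e2 * cd * L) h1 h3 => Y h1 h3; lra.
by rewrite lerXn2r ?nnegrE// (le_trans _ key).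
Qed.

Lemma info_gain_SE_large d : exists2 C : R, 0 < C &
  forall (cd lambda l : R) (T : nat), 0 < lambda -> (0 < T)%N -> 0 < l -> 1 <= cd ->
  let theta := 2 * l ^+ 2 in let L := ln (1 + T%:R / lambda ^+ 2) in
  expR 1 ^+ 2 * cd < theta ->
  (info_gain T (@k_SE R l d) lambda <=
     C / (ln (theta / (expR 1 * cd))) ^+ d * L ^+ d.+1 + C * L + (1 + d%:R))%R.
Proof.
exists (2 ^+ d) => [|cd lambda l T l0 T0 ll0 cd1 theta L th]; first by rewrite exprn_gt0.
have e2 : 2 <= expR 1 :> R by have := expR_ge1Dx (1 : R); lra.
have cd0 : 0 < cd by lra.
have ec0 : 0 < expR 1 * cd by rewrite mulr_gt0 ?expR_gt0.
have th0 : 0 < theta by rewrite mulr_gt0 ?exprn_gt0.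
have tl0 : 0 < T%:R / lambda ^+ 2 by rewrite divr_gt0 ?exprn_gt0 ?ltr0n.
set b := ln _.
have b1 : 1 <= b.
  rewrite -[leLHS]expRK ler_ln ?posrE ?expR_gt0 ?divr_gt0//.
  by rewrite ler_pdivlMr// mulrA -expr2 ltW.
have b0 : 0 < b by lra.
have L0 : 0 <= L by rewrite ln_ge0// lerDl ltW.
have [D D1 D2] := @ceil_nat (L / b) (divr_ge0 L0 (ltW b0)).
have := @info_gain_SE d T lambda l D l0 ll0 T0; rewrite -/theta => /(_ _)/le_trans; apply.
  have hr : (2 / theta) ^+ D / D`!%:R <= expR (- L).
    apply: (@le_trans _ _ ((2 / theta) ^+ D)).
      rewrite ler_pdivrMr ?ltr0n ?fact_gt0// ler_peMr ?exprn_ge0 ?divr_ge0 ?(ltW th0)//.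
      by rewrite ler1n fact_gt0.
    have : 2 / theta <= expR (- b).
      rewrite expRN lnK ?posrE ?divr_gt0// invf_div ler_wpM2r ?invr_ge0 ?(ltW th0)//.
      by rewrite (le_trans e2)// ler_peMr// expR_ge0.
    move=> h; apply: (@le_trans _ _ (expR (- b) ^+ D)).
      by rewrite lerXn2r ?nnegrE ?expR_ge0 ?divr_ge0 ?(ltW th0).
    rewrite -expRM_natl ler_expR mulrN lerN2.
    by rewrite -ler_pdivrMr.
  apply: le_trans (mulr_expRN_ln_le1 tl0); apply: ler_wpM2l hr; exact: ltW.
rewrite lerD2r (exprSr L) [X in _ <= X + _]mulrA -mulrDl; apply: ler_wpM2r => //.
have lb0 : 0 <= L / b by rewrite divr_ge0 ?(ltW b0).
apply: (@le_trans _ _ ((L / b + 1) ^+ d)).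
  by rewrite lerXn2r ?nnegrE// addr_ge0.
apply: (le_trans (expn_addr1_le d lb0)).
by rewrite exprMn exprVn mulrDr mulr1 lerD2r [L ^+ d / _]mulrC mulrA.
Qed.

End squared_exponential.

(** * Interpolation on a grid *)

Section interpolation.
Variable R : realType.

Lemma poly_bound01 (p : {poly R}) (t : R) : 0 <= t <= 1 ->
  `|p.[t]| <= \sum_(i < size p) `|p`_i|.
Proof.
move=> /andP[t0 t1]; rewrite horner_coef.
apply: le_trans (ler_norm_sum _ _ _) _; apply: ler_sum => i _.
by rewrite normrM ler_piMr// normrX exprn_ile1// ger0_norm.
Qed.

(** Lagrange interpolation at the integers [0, ..., m]. The Lebesgue constant on [[0, 1]] is bounded
    by the absolute coefficients of the basis polynomials; the added 1 ensures [1 <= B]. *)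
Lemma lagrange_weights m : exists (w : 'I_m.+1 -> R -> R) (B : R), 1 <= B /\
  (forall (q : {poly R}) t, (size q <= m.+1)%N ->
     \sum_p w p t * q.[(p : nat)%:R] = q.[t]) /\
  (forall t, 0 <= t <= 1 -> \sum_p `|w p t| <= B).
Proof.
pose x (j : nat) : R := j%:R.
pose ell := tnth (@qpoly.lagrange R m.+1 x).
exists (fun p t => (ell p : {poly R}).[t]).
exists (1 + \sum_p \sum_(i < size (ell p : {poly R})) `|(ell p : {poly R})`_i|).
split; first by rewrite lerDl sumr_ge0// => p _; rewrite sumr_ge0.
split=> [q t sq|t t01].
  have xinj : injective x by move=> i j /eqP; rewrite eqr_nat => /eqP.
  have {2}-> := @qpoly.lagrange_gen R m.+1 x isT xinj q sq.
  by rewrite horner_sum; apply: eq_bigr => p _; rewrite hornerM hornerC mulrC.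
rewrite -[leLHS]add0r; apply: lerD => //.
by apply: ler_sum => p _; exact: poly_bound01.
Qed.

(** The interval [[-1, 1]] is cut into [n] cells of length [h = 2 / n], and a point of cell [c] is
    interpolated from the nodes [-1 + h (c + p)] with [p <= m]. The weights depend only on the
    position rescaled to the cell, so [B] does not depend on [n]. Pairs [(c, p)] index the nodes,
    with repetitions, and some nodes may lie beyond 1. *)
Lemma grid_weights m : exists2 B : R, 1 <= B & forall n, (0 < n)%N ->
  exists (y : 'I_n * 'I_m.+1 -> R) (b : R -> 'I_n * 'I_m.+1 -> R),
  forall x, `|x| <= 1 ->
  [/\ forall k, (k <= m)%N -> \sum_q b x q * y q ^+ k = x ^+ k,
      \sum_q `|b x q| <= B &
      forall q, b x q != 0 -> `|x - y q| <= 2 * m.+1%:R / n%:R].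
Proof.
have [w [B [B1 [wpoly wB]]]] := lagrange_weights m.
exists B => // -[//|n] _; pose h : R := 2 / n.+1%:R.
have n0 : 0 < n.+1%:R :> R by rewrite ltr0n.
have h0 : 0 < h by rewrite divr_gt0.
(* The minimum assigns the right endpoint [x = 1] to the last cell, where its rescaled position is
   1. *)
pose c (x : R) : 'I_n.+1 := inord (minn n (Num.truncn ((x + 1) / h))).
pose t (x : R) : R := (x + 1) / h - (c x : nat)%:R.
exists (fun q : 'I_n.+1 * 'I_m.+1 => - 1 + h * ((q.1 : nat)%:R + (q.2 : nat)%:R)).
exists (fun x (q : 'I_n.+1 * 'I_m.+1) => (c x == q.1)%:R * w q.2 (t x)) => x.
rewrite ler_norml => /andP[x1 x2].
have u0 : 0 <= (x + 1) / h by rewrite divr_ge0 ?(ltW h0)//; lra.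
have un : (x + 1) / h <= n.+1%:R.
  rewrite ler_pdivrMr// /h mulrCA mulfV ?gt_eqF//; lra.
have cE : (c x : nat) = minn n (Num.truncn ((x + 1) / h)).
  by rewrite inordK// ltnS geq_minl.
have t01 : 0 <= t x <= 1.
  rewrite /t cE; case: (leqP n (Num.truncn ((x + 1) / h))) => hn.
    have : n%:R <= (x + 1) / h by rewrite -truncn_ge_nat.
    by move: un; rewrite -natr1; lra.
  have := truncn_itv u0; rewrite -natr1; lra.
have sumE (F : 'I_n.+1 * 'I_m.+1 -> R) :
    \sum_q (c x == q.1)%:R * F q = \sum_p F (c x, p).
  transitivity (\sum_i \sum_j (c x == i)%:R * F (i, j)).
    by rewrite pair_bigA; apply: eq_bigr => -[].
  rewrite (bigD1 (c x))//=.
  rewrite [X in _ + X]big1 ?addr0 => [|i /negbTE ic].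
    by apply: eq_bigr => p _; rewrite eqxx mul1r.
  by rewrite big1// => p _; rewrite eq_sym ic mul0r.
have xE : x = - 1 + h * ((c x : nat)%:R + t x).
  by rewrite /t addrCA subrr addr0 mulrC divfK ?gt_eqF//; lra.
split=> [k km||q].
- under eq_bigr do rewrite -mulrA.
  rewrite (sumE (fun q : 'I_n.+1 * 'I_m.+1 =>
    w q.2 (t x) * (- 1 + h * ((q.1 : nat)%:R + (q.2 : nat)%:R)) ^+ k))/=.
  pose q : {poly R} := ((- 1 + h * (c x : nat)%:R)%:P + h *: 'X) ^+ k.
  have qE s : q.[s] = (- 1 + h * ((c x : nat)%:R + s)) ^+ k.
    by rewrite /q !hornerE; congr (_ ^+ _); ring.
  have sq : (size q <= m.+1)%N.
    have s2 : (size (((- 1 + h * (c x : nat)%:R)%:P + h *: 'X)%R : {poly R}) <= 2)%N.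
      apply: leq_trans (size_polyD _ _) _; rewrite geq_max.
      rewrite (leq_trans (size_polyC_leq1 _))//=.
      by rewrite (leq_trans (size_scale_leq _ _))// size_polyX.
    apply: leq_trans (size_poly_exp_leq _ _) _; rewrite ltnS.
    apply: leq_trans km; rewrite -[leqRHS]mul1n leq_mul2r; apply/orP; right.
    by case: (size _) s2 => [|[|[|]]].
  by rewrite [in RHS]xE -qE -(wpoly q _ sq); apply: eq_bigr => p _; rewrite qE.
- under eq_bigr do rewrite normrM (ger0_norm (ler0n _ _)).
  by rewrite (sumE (fun q : 'I_n.+1 * 'I_m.+1 => `|w q.2 (t x)|))/= wB.
- rewrite mulf_eq0 negb_or => /andP[]; rewrite pnatr_eq0 eqb0 negbK => /eqP <- _.
  rewrite {1}xE (_ : _ - _ = h * (t x - (q.2 : nat)%:R)); last by ring.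
  rewrite normrM gtr0_norm// /h mulrAC ler_pM2r ?invr_gt0// ler_pM2l// ler_norml.
  have : (q.2 : nat)%:R <= m%:R :> R by rewrite ler_nat -ltnS ltn_ord.
  have : 0 <= (q.2 : nat)%:R :> R by [].
  have : 0 <= m%:R :> R by [].
  by rewrite -natr1; lra.
Qed.

Lemma prod_seq_count d (F : 'I_d -> R) (s : seq 'I_d) :
  \prod_(j <- s) F j = \prod_j F j ^+ count_mem j s.
Proof.
elim: s => [|a s IH]; first by rewrite big_nil big1.
rewrite big_cons IH; under [RHS]eq_bigr do rewrite /= exprD.
rewrite big_split/=; congr (_ * _).
rewrite (bigD1 a)//= eqxx expr1 big1 ?mulr1// => j /negbTE.
by rewrite eq_sym => ->.
Qed.

(** Product weights reproduce monomials coordinate by coordinate. A monomial is encoded as the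
    sequence of its coordinates with multiplicity, so its total degree is the size of the sequence
    and bounds each partial degree. *)
Lemma tensor_weights m d : exists2 B : R, 1 <= B & forall n, (0 < n)%N ->
  exists (z : {ffun 'I_d -> 'I_n * 'I_m.+1} -> 'rV[R]_d)
    (a : 'rV[R]_d -> {ffun 'I_d -> 'I_n * 'I_m.+1} -> R),
  forall x : 'rV[R]_d, (forall i, `|x 0 i| <= 1) ->
  [/\ forall s : seq 'I_d, (size s <= m)%N ->
        \sum_e a x e * (\prod_(j <- s) z e 0 j) = \prod_(j <- s) x 0 j,
      \sum_e `|a x e| <= B &
      forall e, a x e != 0 -> forall i, `|x 0 i - z e 0 i| <= 2 * m.+1%:R / n%:R].
Proof.
have [B B1 hB] := grid_weights m.
exists (B ^+ d) => [|n n0]; first exact: exprn_ege1.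
have [y [b yb]] := hB _ n0.
exists (fun e => \row_i y (e i)), (fun x e => \prod_i b (x 0 i) (e i)) => x x1.
split=> [s sm||e].
- rewrite [RHS]prod_seq_count.
  have -> : \prod_j x 0 j ^+ count_mem j s =
      \prod_j \sum_q b (x 0 j) q * y q ^+ count_mem j s.
    apply: eq_bigr => j _; have [-> //] := yb _ (x1 j).
    exact: leq_trans (count_size _ _) sm.
  rewrite (bigA_distr_bigA (fun j q => b (x 0 j) q * y q ^+ count_mem j s)).
  apply: eq_bigr => e _; rewrite prod_seq_count -big_split/=.
  by apply: eq_bigr => j _; rewrite mxE.
- under eq_bigr do rewrite normr_prod.
  rewrite -(bigA_distr_bigA (fun j q => `|b (x 0 j) q|)).
  rewrite -[X in _ ^+ X]card_ord -prodr_const; apply: ler_prod => j _.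
  by rewrite sumr_ge0//=; have [] := yb _ (x1 j).
- move=> /prodf_neq0 h i; rewrite mxE; have [_ _] := yb _ (x1 i); apply.
  exact: h.
Qed.

(** * Signed measures that annihilate polynomials of degree at most m *)

Section annihilating_weights.
Variables (m d : nat) (I : finType) (w : I -> R) (z : I -> 'rV[R]_d).
Hypothesis w0 : forall s : seq 'I_d, (size s <= m)%N ->
  \sum_p w p * (\prod_(j <- s) z p 0 j) = 0.
Let dist p q := \sum_j (z p 0 j - z q 0 j) ^+ 2.

(** Each factor [dist] is expanded as a sum of [x_j^2 - 2 x_j y_j + y_j^2], until the double sum
    splits into a product of two moments. A total degree of at most [2 m + 1] forces one of them to
    have degree at most [m], hence to vanish. *)
Lemma annihilate_dist k (s t : seq 'I_d) : (size s + size t + k.*2 <= m.*2.+1)%N ->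
  \sum_p \sum_q w p * w q *
    ((\prod_(j <- s) z p 0 j) * (\prod_(j <- t) z q 0 j) * dist p q ^+ k) = 0.
Proof.
elim: k s t => [|k IH] s t st.
  rewrite (_ : \sum_p _ = (\sum_p w p * (\prod_(j <- s) z p 0 j)) *
     (\sum_p w p * (\prod_(j <- t) z p 0 j))).
    have [sm|sm] := leqP (size s) m; first by rewrite w0// mul0r.
    rewrite [X in _ * X]w0 ?mulr0//.
    by move: st; rewrite double0 addn0 -addnn => st; lia.
  rewrite mulr_suml; apply: eq_bigr => p _; rewrite mulr_sumr.
  by apply: eq_bigr => q _; rewrite expr0; ring.
pose F (s t : seq 'I_d) p q :=
  w p * w q * ((\prod_(j <- s) z p 0 j) * (\prod_(j <- t) z q 0 j) * dist p q ^+ k).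
rewrite (_ : \sum_p _ = \sum_j (\sum_p \sum_q F (j :: j :: s) t p q
   - 2 * (\sum_p \sum_q F (j :: s) (j :: t) p q) + \sum_p \sum_q F s (j :: j :: t) p q)).
  by apply: big1 => j _; rewrite /F !IH /= ?mulr0 ?subr0 ?addr0//; move: st; rewrite doubleS; lia.
under [RHS]eq_bigr do rewrite mulr_sumr -sumrB -big_split/=.
rewrite [RHS]exchange_big/=; apply: eq_bigr => p _.
under [RHS]eq_bigr do rewrite mulr_sumr -sumrB -big_split/=.
rewrite [RHS]exchange_big/=; apply: eq_bigr => q _.
rewrite exprSr {2}/dist !mulr_sumr; apply: eq_bigr => j _.
by rewrite /F !big_cons; ring.
Qed.

Variables (W sig : R).
Hypothesis wW : \sum_p `|w p| <= W.
Hypothesis wsig : forall p q, w p != 0 -> w q != 0 -> dist p q <= sig.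

(** If [rho * sig <= 1], the Taylor polynomial of degree [m] in the squared distance is annihilated
    and only the remainder counts; otherwise the bound [gauss <= 1] suffices. *)
Lemma annihilate_gauss rho : 0 <= rho -> 0 <= sig ->
  \sum_p \sum_q w p * w q * gauss rho (z p) (z q) <=
  expR 1 * W ^+ 2 * Num.min 1 ((rho * sig) ^+ m.+1).
Proof.
move=> r0 s0.
have W0 : 0 <= W by apply: le_trans wW; rewrite sumr_ge0.
have dist0 p q : 0 <= dist p q by rewrite sumr_ge0// => j _; exact: sqr_ge0.
have dbl (F : I -> I -> R) (C : R) : 0 <= C ->
    (forall p q, w p != 0 -> w q != 0 -> `|F p q| <= C) ->
    \sum_p \sum_q w p * w q * F p q <= C * W ^+ 2.
  move=> C0 hF; apply: (@le_trans _ _ (C * ((\sum_p `|w p|) * (\sum_q `|w q|)))).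
    rewrite mulr_suml mulr_sumr; apply: ler_sum => p _.
    rewrite !mulr_sumr; apply: ler_sum => q _.
    have [->|wp] := eqVneq (w p) 0; first by rewrite !mul0r normr0 mul0r mulr0.
    have [->|wq] := eqVneq (w q) 0; first by rewrite mulr0 !mul0r normr0 !mulr0.
    apply: le_trans (ler_norm _) _; rewrite !normrM mulrC.
    by apply: ler_wpM2r; [rewrite mulr_ge0|exact: hF].
  by rewrite ler_wpM2l// expr2 ler_pM// sumr_ge0.
have b1 : \sum_p \sum_q w p * w q * gauss rho (z p) (z q) <= W ^+ 2.
  rewrite -[leRHS]mul1r; apply: dbl => // p q _ _.
  rewrite ger0_norm ?expR_ge0// -[leRHS]expR0 ler_expR oppr_le0.
  by rewrite mulr_ge0// dist0.
have e1 : 1 <= expR 1 :> R by rewrite -[leLHS]expR0 ler_expR.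
have [rs|rs] := leP (rho * sig) 1; last first.
  rewrite min_l ?exprn_ege1 ?(ltW rs)// mulr1 (le_trans b1)//.
  by rewrite ler_peMl// exprn_ge0.
rewrite min_r ?exprn_ile1 ?mulr_ge0//.
have -> : \sum_p \sum_q w p * w q * gauss rho (z p) (z q) =
    \sum_p \sum_q w p * w q * (gauss rho (z p) (z q) -
      \sum_(k < m.+1) (- (rho * dist p q)) ^+ k / k`!%:R).
  symmetry; under eq_bigr do under eq_bigr do rewrite mulrBr.
  under eq_bigr do rewrite sumrB.
  rewrite sumrB -[RHS]subr0; congr (_ - _).
  under eq_bigr do under eq_bigr do rewrite mulr_sumr.
  under eq_bigr do rewrite exchange_big/=.
  rewrite exchange_big/= big1// => k _.
  have km : (k.*2 <= m.*2.+1)%N by rewrite leqW// leq_double -ltnS.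
  have H := @annihilate_dist k [::] [::] km.
  transitivity ((- rho) ^+ k / k`!%:R * 0); last by rewrite mulr0.
  rewrite -[X in _ = _ * X]H [RHS]mulr_sumr; apply: eq_bigr => p _.
  rewrite [RHS]mulr_sumr.
  apply: eq_bigr => q _; rewrite !big_nil -mulNr exprMn; ring.
rewrite mulrAC; apply: dbl => [|p q wp wq].
  by rewrite mulr_ge0 ?expR_ge0 ?exprn_ge0 ?mulr_ge0.
have rd : rho * dist p q <= rho * sig by rewrite ler_wpM2l// wsig.
apply: le_trans (exp_taylor _ _) _.
have rd0 : 0 <= rho * dist p q by apply: mulr_ge0 => //; exact: dist0.
rewrite normrN (ger0_norm rd0).
apply: ler_pM; first exact: expR_ge0; first by rewrite divr_ge0 ?exprn_ge0.
  by rewrite ler_expR (le_trans rd).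
rewrite ler_pdivrMr ?ltr0n ?fact_gt0//.
apply: (@le_trans _ _ ((rho * sig) ^+ m.+1)).
  by apply: lerXn2r; rewrite ?nnegrE// mulr_ge0.
by rewrite ler_peMr ?exprn_ge0 ?mulr_ge0// ler1n fact_gt0.
Qed.

End annihilating_weights.
End interpolation.

(** * Gamma and Bessel integrals on the line *)

Section gamma_mixture.
Variable R : realType.
Local Open Scope classical_set_scope.
Notation mu := (@lebesgue_measure R).

(** For [q = 0] this is the integrand of [Gamma(nu)] in the variable [u = exp s]; the term in [q]
    will carry the squared distance of the Matern kernel. *)
Definition mix (nu q s : R) : R := expR (nu * s - expR s - q * expR (- s)).

Definition laplace (eta s : R) : R := expR (- (eta * `|s|)).

Lemma continuous_mix nu q : continuous (mix nu q).
Proof.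
move=> s; apply: continuous_comp; last exact: continuous_expR.
apply: cvgB.
  apply: cvgB; last exact: continuous_expR.
  by apply: cvgM; [exact: cvg_cst|exact: cvg_id].
apply: cvgM; first exact: cvg_cst.
apply: continuous_comp; [exact: continuousN|exact: continuous_expR].
Qed.

Lemma continuous_laplace eta : continuous (laplace eta).
Proof.
move=> s; apply: continuous_comp; last exact: continuous_expR.
apply: cvgN; apply: cvgM; first exact: cvg_cst.
exact: norm_continuous.
Qed.

Lemma mix_ge0 nu q s : 0 <= mix nu q s.
Proof. exact: expR_ge0. Qed.

Lemma integral_shift (f : R -> R) (c : R) : continuous f -> (forall x, 0 <= f x) ->
  (\int[mu]_x (f x)%:E = \int[mu]_x (f (x + c))%:E)%E.
Proof.
move=> cf f0.
have dF : (fun x : R => x + c)^`() = cst 1.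
  apply/funext => x; rewrite derive1E; exact: (congr1 (fun f => f x) (derive_shift 1 c)).
rewrite (@increasing_ge0_integration_by_substitutionT R (fun x => x + c) f)//.
- by apply: eq_integral => x _; rewrite dF /= mulr1.
- by move=> x y xy; rewrite ltrD2r.
- by rewrite dF => x; exact: cvg_cst.
- by rewrite dF; exact: is_cvg_cst.
- by rewrite dF; exact: is_cvg_cst.
- exact: cvg_addrr_Ny.
- exact: cvg_addrr.
Qed.

Lemma integrable_laplace eta : 0 < eta ->
  mu.-integrable setT (EFin \o laplace eta).
Proof.
move=> e0; apply/integrableP; split.
  by apply/measurable_EFinP; apply: continuous_measurable_fun; exact: continuous_laplace.
under eq_integral do rewrite /= ger0_norm ?expR_ge0//.
rewrite ge0_symfun_integralT//; last 3 first.
  by move=> x; exact: expR_ge0.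
  exact: continuous_laplace.
  by move=> x; rewrite /laplace/= normrN.
rewrite lte_mul_pinfty//.
apply: (@le_lt_trans _ _ (\int[mu]_(x in [set x : R | (0 <= x)%R])
   ((eta^-1)%:E * (exponential_pdf eta x)%:E)))%E.
  apply: ge0_le_integral => //.
  - by rewrite -set_itvcy.
  - by move=> x _; rewrite lee_fin expR_ge0.
  - by apply/measurable_EFinP; apply: measurable_funTS;
      apply: continuous_measurable_fun; exact: continuous_laplace.
  - by apply: measurable_funTS; apply: measurable_funeM; apply/measurable_EFinP;
      exact: measurable_exponential_pdf.
  - move=> x /= x0; rewrite -EFinM lee_fin exponential_pdfE// mulKf ?gt_eqF//.
    by rewrite /laplace ger0_norm// mulNr.
rewrite ge0_integralZl//.
- rewrite lte_mul_pinfty ?lee_fin ?invr_ge0 ?(ltW e0)//.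
  apply: (@le_lt_trans _ _ (\int[mu]_x (exponential_pdf eta x)%:E))%E.
    apply: ge0_subset_integral => //.
    + by rewrite -set_itvcy.
    + by apply/measurable_EFinP; exact: measurable_exponential_pdf.
    + by move=> x _; rewrite lee_fin exponential_pdf_ge0// ltW.
  by rewrite integral_exponential_pdf// ltry.
- by rewrite -set_itvcy.
- by apply: measurable_funTS; apply/measurable_EFinP; exact: measurable_exponential_pdf.
- by move=> x _; rewrite lee_fin exponential_pdf_ge0// ltW.
- by rewrite lee_fin invr_ge0 ltW.
Qed.

(** The left side decays at rate [nu] towards minus infinity and at rate [M - nu] towards plus
    infinity. This majorant gives both the integrability of [mix] and the integrated interpolation
    error. *)
Lemma expR_min_laplace nu (M : nat) eta s : 0 < nu -> eta <= nu -> eta <= M%:R - nu ->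
  expR (nu * s) * Num.min 1 (expR (- s) ^+ M) <= laplace eta s.
Proof.
move=> nu0 en eM; rewrite -expRM_natl /laplace.
have [s0|s0] := leP 0 s.
  apply: (@le_trans _ _ (expR (nu * s) * expR (M%:R * - s))).
    by rewrite ler_pM2l ?expR_gt0// ge_min lexx orbT.
  rewrite -expRD ler_expR ger0_norm//.
  have : 0 <= (M%:R - nu - eta) * s by rewrite mulr_ge0// subr_ge0.
  lra.
apply: (@le_trans _ _ (expR (nu * s) * 1)).
  by rewrite ler_pM2l ?expR_gt0// ge_min lexx.
rewrite mulr1 ler_expR ltr0_norm//.
have : 0 <= (nu - eta) * (- s) by rewrite mulr_ge0 ?subr_ge0// oppr_ge0 ltW.
lra.
Qed.

Lemma mix_le_laplace nu (M : nat) eta q s : 0 < nu -> 0 <= q -> eta <= nu ->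
  eta <= M%:R - nu -> mix nu q s <= M`!%:R * laplace eta s.
Proof.
move=> nu0 q0 en eM.
apply: (@le_trans _ _ (M`!%:R * (expR (nu * s) * Num.min 1 (expR (- s) ^+ M)))); last first.
  by rewrite ler_wpM2l// expR_min_laplace.
have F1 : 1 <= M`!%:R :> R by rewrite ler1n fact_gt0.
rewrite mulrCA /mix -addrA expRD ler_pM2l ?expR_gt0//.
apply: (@le_trans _ _ (expR (- expR s))).
  by rewrite ler_expR gerDl oppr_le0 mulr_ge0// expR_ge0.
have h : expR (- expR s) <= M`!%:R * expR (- s) ^+ M.
  rewrite !expRN exprVn.
  have -> : M`!%:R * (expR s ^+ M)^-1 = (expR s ^+ M / M`!%:R)^-1 by rewrite invfM invrK mulrC.
  rewrite lef_pV2 ?posrE ?expR_gt0 ?divr_gt0 ?exprn_gt0 ?expR_gt0 ?ltr0n ?fact_gt0//.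
  exact/exp_term_le/expR_ge0.
rewrite minEle; case: ifP => // _; rewrite mulr1 (le_trans _ F1)//.
Qed.

Lemma integrable_mix nu q : 0 < nu -> 0 <= q -> mu.-integrable setT (EFin \o mix nu q).
Proof.
move=> nu0 q0.
pose M := (Num.truncn nu).+1; pose eta := Num.min nu (M%:R - nu).
have nM : 0 < M%:R - nu by rewrite subr_gt0 truncnS_gt.
have e0 : 0 < eta by rewrite lt_min nu0.
have := integrableZl measurableT M`!%:R (integrable_laplace e0).
apply: le_integrable => //.
  by apply/measurable_EFinP; apply: continuous_measurable_fun; exact: continuous_mix.
move=> x _ /=; rewrite lee_fin !ger0_norm ?mix_ge0 ?mulr_ge0 ?expR_ge0//.
by apply: mix_le_laplace; rewrite // /eta ge_min lexx ?orbT.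
Qed.

(** By parity the integral becomes half of that of [exp (nu t - z cosh t)] over the line; the
    translation [t = s - ln (z / 2)] turns [z cosh t] into [exp s + (z^2 / 4) exp (- s)]. *)
Lemma BesselK_mix nu z : 0 < z -> 0 < nu ->
  BesselK nu z = 2^-1 * expR (- (nu * ln (z / 2))) * \int[mu]_s mix nu (z ^+ 2 / 4) s.
Proof.
move=> z0 nu0; have z20 : 0 < z / 2 by rewrite divr_gt0.
pose g (t : R) := expR (nu * t - z * coshR t).
have cg : continuous g.
  move=> s; apply: continuous_comp; last exact: continuous_expR.
  apply: cvgB; first by apply: cvgM; [exact: cvg_cst|exact: cvg_id].
  apply: cvgM; first exact: cvg_cst.
  apply: cvgM; last exact: cvg_cst.
  apply: cvgD; first exact: continuous_expR.
  apply: continuous_comp; [exact: continuousN|exact: continuous_expR].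
have cgN : continuous (g \o -%R).
  by move=> s; apply: continuous_comp; [exact: continuousN|exact: cg].
have mg : measurable_fun setT g by exact: continuous_measurable_fun.
have mgN : measurable_fun setT (g \o -%R) by exact: continuous_measurable_fun.
have g0 t : 0 <= g t by exact: expR_ge0.
have gE : (\int[mu]_(t in `[0%R, +oo[) (expR (- (z * coshR t)) * coshR (nu * t))%:E =
    2^-1%:E * \int[mu]_t (g t)%:E)%E.
  rewrite -(setUv `[0, +oo[%classic) ge0_integral_setU//=; last 4 first.
  - exact: measurableC.
  - by apply/measurable_EFinP; rewrite setUv.
  - by move=> t _; rewrite lee_fin.
  - exact/disj_setPCl.
  rewrite setCitvr integral_itv_bndo_bndc; last exact/measurable_EFinP/measurable_funTS.
  have mgN' : measurable_fun [set: R] (fun t : R => (g (- t))%:E) by exact/measurable_EFinP.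
  have gN0 t : (0 <= (g (- t))%:E)%E by rewrite lee_fin.
  have := ge0_integration_by_substitution0 mgN' gN0.
  under [X in _ = X]eq_integral do rewrite opprK.
  move=> <-.
  rewrite -ge0_integralD//; last 2 first.
  - exact/measurable_EFinP/measurable_funTS.
  - exact/measurable_EFinP/measurable_funTS.
  rewrite -ge0_integralZl//; last 2 first.
  - by apply/measurable_EFinP/measurable_funTS; apply: measurable_funD.
  - by move=> t _; rewrite -EFinD lee_fin addr_ge0.
  apply: eq_integral => t _; rewrite -EFinD -EFinM; congr EFin.
  rewrite /g /coshR opprK mulrN [expR (- t) + expR t]addrC !expRD; ring.
  by move=> t _; rewrite lee_fin.
have shE s : g (s - ln (z / 2)) = expR (- (nu * ln (z / 2))) * mix nu (z ^+ 2 / 4) s.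
  rewrite /g /mix -expRD; congr expR; rewrite /coshR opprB !expRD !expRN lnK ?posrE//.
  by field; rewrite ?gt_eqF ?expR_gt0.
rewrite /BesselK gE (integral_shift (- ln (z / 2)) cg g0).
under eq_integral do rewrite shE EFinM.
have imix := @integrable_mix nu (z ^+ 2 / 4) nu0 (divr_ge0 (sqr_ge0 _) (ler0n _ _)).
rewrite integralZl// /Rintegral -mulrA fineM//; last first.
  by rewrite fin_numM//; exact: integrable_fin_num.
by rewrite fineM//; exact: integrable_fin_num.
Qed.

(** The substitution [u = exp s] is made on the compact intervals [[exp (- n), exp n]], and monotone
    convergence extends it to the half-line. *)
Lemma GammaR_mix nu : 0 < nu -> GammaR nu = \int[mu]_s mix nu 0 s.
Proof.
move=> nu0; rewrite /GammaR /Rintegral; congr fine.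
pose H (u : R) := expR ((nu - 1) * ln u) * expR (- u).
have cH u : 0 < u -> {for u, continuous H}.
  move=> u0; apply: cvgM.
    apply: continuous_comp; last exact: continuous_expR.
    by apply: cvgM; [exact: cvg_cst|exact: continuous_ln].
  by apply: continuous_comp; [exact: continuousN|exact: continuous_expR].
have H0 u : 0 <= H u by rewrite mulr_ge0 ?expR_ge0.
have dexp : (@expR R)^`() = expR.
  by apply/funext => x; rewrite derive1E; exact: (congr1 (fun f => f x) (@derive_expR R)).
transitivity (\int[mu]_(u in `]0%R, +oo[) (H u)%:E)%E.
  apply: eq_integral => u; rewrite inE/= in_itv/= andbT => u0.
  by rewrite /H /powR gt_eqF.
pose A (n : nat) : set R := `[expR (- n%:R), expR n%:R].
pose B (n : nat) : set R := `[- n%:R, n%:R].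
have AB n : (\int[mu]_(u in A n) (H u)%:E = \int[mu]_(s in B n) (mix nu 0 s)%:E)%E.
  rewrite /A (@integration_by_substitution_increasing R expR H).
  - apply: eq_integral => s _; rewrite dexp; congr EFin.
    by rewrite !fctE /H /mix expRK mul0r subr0 -!expRD; congr expR; ring.
  - by have := ler0n R n; lra.
  - by move=> x y _ _; rewrite ltr_expR.
  - by move=> x _; rewrite dexp; exact: continuous_expR.
  - rewrite dexp; apply/cvg_ex; eexists; apply: cvg_at_right_filter; exact: continuous_expR.
  - rewrite dexp; apply/cvg_ex; eexists; apply: cvg_at_left_filter; exact: continuous_expR.
  - split=> [x _||].
    + exact: ex_derive.
    + apply: cvg_at_right_filter; exact: continuous_expR.
    + apply: cvg_at_left_filter; exact: continuous_expR.
  - apply: continuous_in_subspaceT => x; rewrite inE/= in_itv/= => /andP[x0 _].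
    by apply: cH; apply: lt_le_trans x0; exact: expR_gt0.
have nat_le (a b : nat) : (a <= b)%N -> a%:R <= b%:R :> R by rewrite ler_nat.
have bA : \bigcup_n A n = `]0, +oo[.
  apply/seteqP; split=> [x [n _]|x].
    rewrite /A/= !in_itv/= => /andP[x0 _]; rewrite andbT.
    by apply: lt_le_trans x0; exact: expR_gt0.
  rewrite /= in_itv/= andbT => x0.
  have [n nx _] := ceil_nat (normr_ge0 (ln x)).
  exists n => //; rewrite /A/= in_itv/= -{1 2}(lnK (x := x)) ?posrE// !ler_expR.
  by rewrite -ler_norml.
have bB : \bigcup_n B n = [set: R].
  apply/seteqP; split=> // x _.
  have [n nx _] := ceil_nat (normr_ge0 x).
  by exists n => //; rewrite /B/= in_itv/= -ler_norml.
have mH n : measurable_fun (A n) (EFin \o H).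
  have AS : A n `<=` `]0, +oo[.
    move=> x; rewrite /A/= !in_itv/= => /andP[x0 _]; rewrite andbT.
    by apply: lt_le_trans x0; exact: expR_gt0.
  apply/measurable_EFinP; apply: measurable_funS AS _; first exact: measurable_itv.
  apply: open_continuous_measurable_fun; first exact: interval_open.
  by move=> x; rewrite inE/= in_itv/= andbT => x0; exact: cH.
have cA : (\int[mu]_(u in A n) (EFin \o H) u @[n --> \oo] -->
    \int[mu]_(u in `]0%R, +oo[) (EFin \o H) u)%E.
  rewrite -bA; apply: ge0_nondecreasing_set_cvg_integral => //.
  - move=> m n mn; rewrite subsetEset => x; rewrite /A/= !in_itv/= => /andP[h1 h2].
    apply/andP; split; [apply: le_trans h1|apply: (le_trans h2)];
      rewrite ler_expR ?lerN2; exact: nat_le.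
  - by move=> n; exact: measurable_itv.
  - by move=> n x _; rewrite lee_fin.
have cB : (\int[mu]_(s in B n) (mix nu 0 s)%:E @[n --> \oo] --> \int[mu]_s (mix nu 0 s)%:E)%E.
  rewrite -bB; apply: ge0_nondecreasing_set_cvg_integral => //.
  - move=> m n mn; rewrite subsetEset => x; rewrite /B/= !in_itv/= => /andP[h1 h2].
    apply/andP; split; [apply: le_trans h1|apply: (le_trans h2)]; rewrite ?lerN2; exact: nat_le.
  - by move=> n; exact: measurable_itv.
  - by move=> n; apply/measurable_EFinP; apply: measurable_funTS;
      apply: continuous_measurable_fun; exact: continuous_mix.
  - by move=> n x _; rewrite lee_fin mix_ge0.
apply: cvg_unique cA _ => //.
rewrite (_ : (fun n => _) = (fun n => \int[mu]_(s in B n) (mix nu 0 s)%:E)%E)//.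
by apply/funext => n; exact: AB.
Qed.

End gamma_mixture.

(** * Matern kernel *)

Section matern.
Variable R : realType.
Local Open Scope classical_set_scope.
Notation mu := (@lebesgue_measure R).

Lemma Rintegral_lincomb (I : finType) (c : I -> R) (f : I -> R -> R) :
  (forall i, mu.-integrable setT (EFin \o f i)) ->
  mu.-integrable setT (EFin \o (fun s => \sum_i c i * f i s)) /\
  \sum_i c i * \int[mu]_s f i s = \int[mu]_s (\sum_i c i * f i s).
Proof.
move=> fi; elim: (index_enum I) => [|i r [IH1 IH2]].
  under eq_fun do rewrite big_nil.
  split; first exact: integrable0.
  by rewrite big_nil Rintegral_cst// mul0r.
have cfi : mu.-integrable setT (EFin \o (fun s => c i * f i s)).
  exact: (integrableZl measurableT (c i) (fi i)).
rewrite (_ : EFin \o _ = EFin \o (fun s => c i * f i s + \sum_(j <- r) c j * f j s)).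
  split; first exact: (integrableD measurableT cfi IH1).
  rewrite big_cons IH2 -RintegralZl// -RintegralD//.
  by apply: eq_Rintegral => s _; rewrite big_cons.
by apply/funext => s /=; rewrite big_cons.
Qed.

Lemma mix0_int_gt0 nu : 0 < nu -> 0 < \int[mu]_s mix nu 0 s.
Proof.
move=> nu0; have im := integrable_mix nu0 (lexx (0 : R)).
apply: (@lt_le_trans _ _ (expR (- expR 1))); first exact: expR_gt0.
rewrite -lee_fin /Rintegral fineK; last exact: integrable_fin_num.
apply: (@le_trans _ _ (\int[mu]_(s in `[0%R, 1%R]) (mix nu 0 s)%:E)%E); last first.
  apply: ge0_subset_integral => //.
  - exact: measurable_int im.
  - by move=> s _; rewrite lee_fin mix_ge0.
apply: (@le_trans _ _ (\int[mu]_(s in `[0%R, 1%R]) (cst (expR (- expR 1))%:E) s)%E).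
  by rewrite integral_cst//= lebesgue_measure_itv/= lte_fin ltr01 oppr0 addr0 mule1.
apply: ge0_le_integral => //.
- by move=> s _; rewrite lee_fin expR_ge0.
- by apply: measurable_funTS; exact: measurable_int im.
- move=> s /=; rewrite in_itv/= => /andP[s0 s1]; rewrite lee_fin ler_expR mul0r subr0.
  have : expR s <= expR 1 by rewrite ler_expR.
  have : 0 <= nu * s by rewrite mulr_ge0// ltW.
  lra.
Qed.

(** The powers of 2 and of [z] cancel against the prefactor of [BesselK_mix], and
    [z^2 / 4 = nu r^2 / (2 l^2)]. At distance 0 the integral is [Gamma(nu)], in agreement with the
    value 1. *)
Lemma k_Matern_mix nu l d (x y : 'rV[R]_d) : 0 < nu -> 0 < l ->
  k_Matern nu l x y = (GammaR nu)^-1 *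
    \int[mu]_s mix nu (nu / (2 * l ^+ 2) * \sum_i (x 0 i - y 0 i) ^+ 2) s.
Proof.
move=> nu0 l0; have G0 : 0 < GammaR nu by rewrite GammaR_mix// mix0_int_gt0.
have sE : \sum_i (x 0 i - y 0 i) ^+ 2 = enorm (x - y) ^+ 2.
  by rewrite enorm_sqr; apply: eq_bigr => i _; rewrite !mxE.
rewrite sE /k_Matern; set r := enorm _; case: ifPn => [/eqP ->|r0].
  by rewrite expr0n mulr0 -GammaR_mix// mulVf// gt_eqF.
have rp : 0 < r by rewrite lt_neqAle eq_sym r0 sqrtr_ge0.
have n20 : 0 < Num.sqrt (2 * nu) by rewrite sqrtr_gt0 mulr_gt0.
set z := _ * r / l; have z0 : 0 < z by rewrite divr_gt0// mulr_gt0.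
rewrite BesselK_mix//.
have -> : z ^+ 2 / 4 = nu / (2 * l ^+ 2) * r ^+ 2.
  rewrite /z !exprMn sqr_sqrtr ?mulr_ge0 ?(ltW nu0)//.
  by field; rewrite gt_eqF.
have -> : ln (z / 2) = ln z - ln 2 by move: (z) z0 => t t0; rewrite ln_div ?posrE.
rewrite /powR !gt_eqF//.
have -> : expR ((1 - nu) * ln 2) = 2 * expR (- (nu * ln 2)) :> R.
  by rewrite mulrBl mul1r expRD lnK ?posrE.
set J := Rintegral _ _ _.
have h : expR (- (nu * ln 2)) * expR (nu * ln z) * expR (- (nu * (ln z - ln 2))) = 1 :> R.
  by rewrite -!expRD -[RHS]expR0; congr expR; ring.
transitivity ((GammaR nu)^-1 * J * (expR (- (nu * ln 2)) * expR (nu * ln z) *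
   expR (- (nu * (ln z - ln 2))))); last by rewrite h mulr1.
by field; rewrite gt_eqF.
Qed.

Lemma mix_gauss nu a d (x y : 'rV[R]_d) s :
  mix nu (a * \sum_i (x 0 i - y 0 i) ^+ 2) s = mix nu 0 s * gauss (a * expR (- s)) x y.
Proof. by rewrite /mix /gauss -expRD; congr expR; ring. Qed.

(** A quadratic form of the Matern kernel is a mixture of Gaussian ones, so positivity and error
    bounds can be proved under the integral. *)
Lemma k_Matern_quad nu l d (I : finType) (w : I -> R) (z : I -> 'rV[R]_d) :
  0 < nu -> 0 < l ->
  let Q s := mix nu 0 s * \sum_p \sum_q w p * w q *
     gauss (nu / (2 * l ^+ 2) * expR (- s)) (z p) (z q) in
  mu.-integrable setT (EFin \o Q) /\
  \sum_p \sum_q w p * w q * k_Matern nu l (z p) (z q) =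
    (GammaR nu)^-1 * \int[mu]_s Q s.
Proof.
move=> nu0 l0 Q; pose a := nu / (2 * l ^+ 2).
have a0 : 0 <= a by rewrite divr_ge0 ?mulr_ge0 ?sqr_ge0 ?ltW.
pose f (pq : I * I) s := mix nu (a * \sum_i (z pq.1 0 i - z pq.2 0 i) ^+ 2) s.
have fi pq : mu.-integrable setT (EFin \o f pq).
  by apply: integrable_mix => //; rewrite mulr_ge0// sumr_ge0// => i _; exact: sqr_ge0.
have [h1 h2] := Rintegral_lincomb (fun pq : I * I => w pq.1 * w pq.2) fi.
have QE : (fun s => \sum_pq w pq.1 * w pq.2 * f pq s) = Q.
  apply/funext => s; rewrite /Q mulr_sumr.
  rewrite -(pair_bigA _ (fun p q => w p * w q * f (p, q) s))/=.
  apply: eq_bigr => p _; rewrite mulr_sumr; apply: eq_bigr => q _.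
  by rewrite /f mix_gauss mulrCA.
rewrite -QE; split=> //; rewrite -h2 mulr_sumr.
rewrite (pair_bigA _ (fun p q => w p * w q * k_Matern nu l (z p) (z q)))/=.
by apply: eq_bigr => -[p q] _ /=; rewrite k_Matern_mix// mulrCA.
Qed.

Lemma k_Matern_psd nu l d (I : finType) (w : I -> R) (z : I -> 'rV[R]_d) :
  (0 < d)%N -> 0 < nu -> 0 < l ->
  0 <= \sum_p \sum_q w p * w q * k_Matern nu l (z p) (z q).
Proof.
move=> d0 nu0 l0; have [_ ->] := k_Matern_quad w z nu0 l0.
rewrite mulr_ge0 ?invr_ge0 ?GammaR_mix ?(ltW (mix0_int_gt0 _))//.
apply: Rintegral_ge0 => s _; rewrite mulr_ge0 ?mix_ge0// gauss_psd//.
by rewrite mulr_ge0 ?expR_ge0// divr_ge0 ?mulr_ge0 ?sqr_ge0 ?ltW.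
Qed.

Lemma k_Maternxx nu l d (x : 'rV[R]_d) : 0 < nu -> 0 < l -> k_Matern nu l x x = 1.
Proof.
move=> nu0 l0; rewrite k_Matern_mix// big1 ?mulr0.
  by rewrite -GammaR_mix// mulVf// GammaR_mix// gt_eqF// mix0_int_gt0.
by move=> i _; rewrite subrr expr0n.
Qed.

Lemma k_MaternC nu l d (x y : 'rV[R]_d) : 0 < nu -> 0 < l ->
  k_Matern nu l x y = k_Matern nu l y x.
Proof.
move=> nu0 l0; rewrite !k_Matern_mix//; congr (_ * _).
by rewrite (eq_bigr (fun i => (y 0 i - x 0 i) ^+ 2))// => i _; rewrite -sqrrN opprB.
Qed.

Lemma integrable_laplace_shift eta c : 0 < eta ->
  mu.-integrable setT (EFin \o (fun s => laplace eta (s + c))) /\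
  \int[mu]_s laplace eta (s + c) = \int[mu]_s laplace eta s.
Proof.
move=> e0; have il := integrable_laplace e0.
have l0 s : 0 <= laplace eta s by exact: expR_ge0.
have sE := integral_shift c (@continuous_laplace R eta) l0.
split; last by rewrite /Rintegral -sE.
have cl : continuous (fun s => laplace eta (s + c)).
  move=> s; apply: (@continuous_comp _ _ _ (fun s => s + c) (laplace eta)).
    by apply: cvgD; [exact: cvg_id|exact: cvg_cst].
  exact: continuous_laplace.
apply/integrableP; split.
  by apply/measurable_EFinP; exact: continuous_measurable_fun.
under eq_integral do rewrite /= ger0_norm//.
rewrite -sE; have /integrableP[_] := il.
by under eq_integral do rewrite /= ger0_norm//.
Qed.

(** Integrating [annihilate_gauss] over the mixture: with [A = a * sig], translating [s] by [ln A]
    extracts the factor [A^nu] and leaves an integral dominated by that of [laplace], independent of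
    [l] and [sig]. Convergence uses [M > nu]. *)
Lemma k_Matern_annihilate nu : 0 < nu -> exists2 C : R, 0 < C &
  forall (l : R) d (I : finType) (w : I -> R) (z : I -> 'rV[R]_d) (W sig : R),
  (0 < d)%N -> 0 < l -> 0 < sig ->
  (forall s : seq 'I_d, (size s <= Num.truncn nu)%N ->
     \sum_p w p * (\prod_(j <- s) z p 0 j) = 0) ->
  \sum_p `|w p| <= W ->
  (forall p q, w p != 0 -> w q != 0 -> \sum_j (z p 0 j - z q 0 j) ^+ 2 <= sig) ->
  \sum_p \sum_q w p * w q * k_Matern nu l (z p) (z q) <=
    C * W ^+ 2 * (nu / (2 * l ^+ 2) * sig) `^ nu.
Proof.
move=> nu0; pose M := (Num.truncn nu).+1; pose eta := Num.min nu (M%:R - nu).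
have e0 : 0 < eta by rewrite lt_min nu0 subr_gt0 truncnS_gt.
have G0 : 0 < GammaR nu by rewrite GammaR_mix// mix0_int_gt0.
pose La := \int[mu]_s laplace eta s.
have La0 : 0 <= La by apply: Rintegral_ge0 => s _; exact: expR_ge0.
exists ((GammaR nu)^-1 * expR 1 * (La + 1)).
  by rewrite mulr_gt0 ?mulr_gt0 ?invr_gt0 ?expR_gt0// ltr_wpDl.
move=> l d I w z W sig d0 l0 s0 wz wW wsig.
have [iQ ->] := k_Matern_quad w z nu0 l0.
set a := nu / (2 * l ^+ 2); pose A := a * sig.
have a0 : 0 < a by rewrite divr_gt0 ?mulr_gt0 ?exprn_gt0.
have A0 : 0 < A by rewrite mulr_gt0.
have [iL EL] := integrable_laplace_shift (- ln A) e0.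
pose K := expR 1 * W ^+ 2 * A `^ nu.
have K0 : 0 <= K by rewrite mulr_ge0 ?powR_ge0// mulr_ge0 ?expR_ge0 ?sqr_ge0.
rewrite (_ : _ * _ * W ^+ 2 * _ = (GammaR nu)^-1 * (K * (La + 1))); last by rewrite /K /A; ring.
rewrite ler_pM2l ?invr_gt0//.
apply: (@le_trans _ _ (\int[mu]_s (K * laplace eta (s - ln A)))).
  apply: le_Rintegral => //; first exact: (integrableZl measurableT K iL).
  move=> s _.
  have aes : 0 <= a * expR (- s) by rewrite mulr_ge0 ?expR_ge0// ltW.
  apply: le_trans (ler_wpM2l (mix_ge0 _ _ _)
    (annihilate_gauss wz wW wsig aes (ltW s0))) _.
  have -> : a * expR (- s) * sig = expR (- (s - ln A)).
    by rewrite opprB expRD lnK ?posrE// /A mulrAC.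
  rewrite -/M /K mulrCA -[leRHS]mulrA; apply: ler_wpM2l.
    by rewrite mulr_ge0 ?expR_ge0 ?sqr_ge0.
  apply: (@le_trans _ _ (expR (nu * s) * Num.min 1 (expR (- (s - ln A)) ^+ M))).
    rewrite ler_wpM2r ?le_min ?ler01 ?exprn_ge0 ?expR_ge0//.
    by rewrite ler_expR mul0r subr0 gerDl oppr_le0 expR_ge0.
  have -> : expR (nu * s) = A `^ nu * expR (nu * (s - ln A)).
    by rewrite /powR gt_eqF// -expRD; congr expR; ring.
  rewrite -mulrA ler_pM2l ?powR_gt0//.
  by apply: expR_min_laplace; rewrite // /eta ge_min lexx ?orbT.
by rewrite RintegralZl// EL -/La ler_wpM2l// lerDl.
Qed.

End matern.

(** * Log-determinant bound for the Matern kernel from grid interpolation *)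

Section matern_gain.
Variable R : realType.

(* The signed measure [delta_x - sum_p a_p delta_(z p)], a point [inl _] standing
   for [x]. *)
Definition err_weight (E : finType) (a : E -> R) (p : 'I_1 + E) : R :=
  if p is inr q then - a q else 1.

Definition err_point d (E : finType) (x : 'rV[R]_d) (z : E -> 'rV[R]_d) (p : 'I_1 + E) :=
  if p is inr q then z q else x.

(** The auxiliary vectors are kernel sections at the nodes, so joint positivity is that of [k] on
    data and nodes together, and the residual is the quadratic form of the error measure. *)
Lemma ln_det_nodes d T (k : 'rV[R]_d -> 'rV[R]_d -> R) (X : 'I_T -> 'rV[R]_d)
    (E : finType) (z : E -> 'rV[R]_d) (a : 'I_T -> E -> R) (e c B r : R) :
  0 < e -> 0 < c -> (forall x y, k x y = k y x) -> (forall x, k x x = 1) ->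
  (forall (I : finType) (u : I -> R) (Z : I -> 'rV[R]_d),
     0 <= \sum_p \sum_q u p * u q * k (Z p) (Z q)) ->
  (forall i, \sum_p `|a i p| <= B) ->
  (forall i, \sum_p \sum_q err_weight (a i) p * err_weight (a i) q *
     k (err_point (X i) z p) (err_point (X i) z q) <= r) ->
  ln (\det (1%:M + c *: gram k X)) <=
    #|E|%:R * ln (1 + c / e) + T%:R * (e * B ^+ 2 + c * r).
Proof.
move=> e0 c0 kC kxx kpsd aB ar.
apply: (@ln_det_features R d T k X E (fun i p => k (X i) (z p))
  (fun p q => k (z p) (z q)) a e c (B ^+ 2) r) => //.
- move=> u w.
  have := kpsd _ (fun p : 'I_T + E => match p with inl i => u i | inr q => w q end)
    (fun p => match p with inl i => X i | inr q => z q end).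
  congr (0 <= _); rewrite big_sumType/=.
  under eq_bigr do rewrite big_sumType/=.
  under [X in _ + X = _]eq_bigr do rewrite big_sumType/=.
  rewrite !big_split/=.
  have -> : \sum_p \sum_(i < T) w p * u i * k (z p) (X i) =
     \sum_(i < T) \sum_p u i * w p * k (X i) (z p).
    rewrite exchange_big/=; apply: eq_bigr => i _; apply: eq_bigr => p _.
    by rewrite kC [w p * _]mulrC.
  by ring.
- by move=> p; rewrite kxx.
- move=> i; apply: (@le_trans _ _ ((\sum_p `|a i p|) ^+ 2)); last first.
    have S0 : 0 <= \sum_p `|a i p| by exact: sumr_ge0.
    by rewrite lerXn2r ?nnegrE// (le_trans S0).
  rewrite expr2 mulr_suml; apply: ler_sum => p _.
  rewrite mulr_sumr (bigD1 p)//= -normrM -expr2 ger0_norm ?sqr_ge0// lerDl.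
  by apply: sumr_ge0 => q _; rewrite mulr_ge0.
- move=> i; apply: le_trans (ar i).
  rewrite big_sumType/= big_ord1 big_sumType/= big_ord1.
  under [X in _ <= _ + X]eq_bigr do rewrite big_sumType/= big_ord1.
  rewrite big_split/=.
  have -> : \sum_p 1 * - a i p * k (X i) (z p) = - \sum_p a i p * k (X i) (z p).
    by rewrite -sumrN; apply: eq_bigr => p _; rewrite mul1r mulNr.
  have -> : \sum_p - a i p * 1 * k (z p) (X i) = - \sum_p a i p * k (X i) (z p).
    by rewrite -sumrN; apply: eq_bigr => p _; rewrite mulr1 mulNr kC.
  have -> : \sum_p \sum_q - a i p * - a i q * k (z p) (z q) =
      \sum_p \sum_q a i p * a i q * k (z p) (z q).
    by apply: eq_bigr => p _; apply: eq_bigr => q _; rewrite mulrNN.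
  lra.
Qed.

Lemma matern_ln_det nu d : 0 < nu -> (0 < d)%N -> exists2 K : nat, (0 < K)%N &
  exists2 C : R, 0 < C &
  forall (l c : R) T n (X : 'I_T -> 'rV[R]_d), 0 < l -> 0 < c -> (0 < T)%N ->
  (0 < n)%N -> (forall i, enorm (X i) <= 1) ->
  ln (\det (1%:M + c *: gram (@k_Matern R nu l d) X)) <=
    ((n * (Num.truncn nu).+1) ^ d)%:R * ln (1 + K%:R * (c * T%:R)) + 1 +
    C * (c * T%:R * ((l * n%:R) ^- 2) `^ nu).
Proof.
move=> nu0 d0; set m := Num.truncn nu.
have [C C0 hC] := k_Matern_annihilate nu0.
have [B B1 hB] := tensor_weights R m d.
have B20 : 0 <= B ^+ 2 by exact: sqr_ge0.
(* With [e = 1 / (T K)] and [K >= B^2], the coefficient term is at most 1, and [c / e] becomes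
   [K c T]. *)
have [K BK _] := ceil_nat B20.
have K1 : 1 <= K%:R :> R by apply: le_trans BK; exact: exprn_ege1.
have Kp : 0 < K%:R :> R by lra.
exists K; first by move: Kp; rewrite ltr0n.
(* Every active point is within [2 (m + 1) / n] of the data point in each coordinate, so two of them
   are at squared distance at most [d (4 (m + 1) / n)^2 = s0 / n^2]. *)
pose s0 : R := 16 * d%:R * m.+1%:R ^+ 2.
have s00 : 0 < s0 by rewrite !mulr_gt0 ?exprn_gt0 ?ltr0n.
exists (C * (1 + B) ^+ 2 * (nu / 2 * s0) `^ nu).
  have B0 : 0 < 1 + B by lra.
  apply: mulr_gt0; first by apply: mulr_gt0 => //; exact: exprn_gt0.
  by apply: powR_gt0; rewrite mulr_gt0// divr_gt0.
move=> l c T n X l0 c0 T0 n0 X1.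
have tp : 0 < T%:R :> R by rewrite ltr0n.
have np : 0 < n%:R :> R by rewrite ltr0n.
have [z [a za]] := hB n n0.
have Xc i j : `|X i 0 j| <= 1 by exact: enorm_coord.
pose sig : R := s0 / n%:R ^+ 2.
have sig0 : 0 < sig by rewrite divr_gt0 ?exprn_gt0.
pose r := C * (1 + B) ^+ 2 * (nu / (2 * l ^+ 2) * sig) `^ nu.
have := @ln_det_nodes d T (@k_Matern R nu l d) X _ z (fun i p => a (X i) p)
  (T%:R * K%:R)^-1 c B r.
rewrite invr_gt0 mulr_gt0// invrK => /(_ isT c0) H; apply: le_trans (H _ _ _ _ _) _.
- by move=> x y; exact: k_MaternC.
- by move=> x; exact: k_Maternxx.
- by move=> I u Z; exact: k_Matern_psd.
- by move=> i; have [_ aB _] := za _ (Xc i).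
- move=> i; have [am aB ad] := za _ (Xc i).
  set w := err_weight _; set Z := err_point _ _.
  have Dle k j : w k != 0 -> `|X i 0 j - Z k 0 j| <= 2 * m.+1%:R / n%:R.
    case: k => [? _|p] /=; first by rewrite subrr normr0 divr_ge0 ?mulr_ge0 ?ltW.
    by rewrite oppr_eq0 => /ad.
  apply: hC => //.
  + move=> s sm; rewrite big_sumType/= big_ord1 mul1r -(am s sm).
    by rewrite -big_split big1// => p _ /=; rewrite mulNr subrr.
  + rewrite big_sumType/= big_ord1 normr1 lerD2l.
    by under eq_bigr do rewrite normrN.
  + move=> p q wp wq.
    apply: (@le_trans _ _ (\sum_(j < d) (2 * (2 * m.+1%:R / n%:R)) ^+ 2)).
      apply: ler_sum => j _; rewrite -real_normK ?num_real//.
      rewrite lerXn2r ?nnegrE ?mulr_ge0 ?divr_ge0 ?mulr_ge0 ?(ltW np)//.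
      rewrite -(subrKA (X i 0 j)) mulrDl mul1r (le_trans (ler_normD _ _))// lerD//.
        by rewrite distrC Dle.
      by rewrite Dle.
    rewrite sumr_const card_ord -mulr_natl /sig /s0 le_eqVlt; apply/orP; left; apply/eqP.
    by field; rewrite gt_eqF.
- rewrite card_ffun card_prod !card_ord -addrA; apply: lerD.
    by rewrite (_ : c * (T%:R * K%:R) = K%:R * (c * T%:R))//; ring.
  rewrite mulrDr; apply: lerD.
    have -> : T%:R * ((T%:R * K%:R)^-1 * B ^+ 2) = B ^+ 2 / K%:R.
      by field; rewrite !gt_eqF.
    by rewrite ler_pdivrMr// mul1r.
  rewrite /r le_eqVlt; apply/orP; left; apply/eqP.
  have -> : nu / (2 * l ^+ 2) * sig = (nu / 2 * s0) * (l * n%:R) ^- 2.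
    by rewrite /sig; field; rewrite !gt_eqF.
  rewrite powRM; [by ring| |].
    by rewrite mulr_ge0 ?divr_ge0 ?(ltW nu0) ?(ltW s00).
  by rewrite invr_ge0 exprn_ge0// mulr_ge0 ?(ltW l0) ?(ltW np).
Qed.

End matern_gain.

(** * Choice of the grid mesh *)

Section matern_info_gain.
Variable R : realType.

(** Bernoulli's inequality [1 + K x <= (1 + x)^K]; it moves the constant [K] out of the
    logarithm. *)
Lemma bernoulli_ln (K : nat) (x : R) : 0 <= x -> ln (1 + K%:R * x) <= K%:R * ln (1 + x).
Proof.
move=> x0; have x1 : 0 < 1 + x by lra.
rewrite [leRHS]mulr_natl -lnXn// ler_ln ?posrE ?exprn_gt0//; last first.
  by rewrite ltr_wpDr// mulr_ge0.
elim: K => [|K IH]; first by rewrite mul0r addr0 expr0.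
rewrite exprS -natr1; apply: le_trans (ler_wpM2l (ltW x1) IH).
have : 0 <= K%:R * x * x by rewrite !mulr_ge0.
lra.
Qed.

Lemma info_gain_Matern nu d : 0 < nu -> (0 < d)%N ->
  exists2 C1 : R, 0 < C1 & exists2 C2 : R, 0 < C2 &
  forall (lambda l : R) T, 0 < lambda -> (0 < T)%N -> 0 < l ->
  let L2 := ln (1 + 2 * T%:R / lambda ^+ 2) in
  let gbar := C1 * L2
       + C2 * (T%:R / (lambda ^+ 2 * l `^ (2 * nu))) `^ (d%:R / (2 * nu + d%:R))
         * L2 `^ (2 * nu / (2 * nu + d%:R)) in
  (0 <= gbar /\ info_gain T (@k_Matern R nu l d) lambda <= gbar + 1)%R.
Proof.
move=> nu0 d0; have [K K0 [C C0 hC]] := matern_ln_det nu0 d0.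
pose A : R := (2 * (Num.truncn nu).+1%:R) ^+ d * K%:R.
have A0 : 0 < A by rewrite mulr_gt0 ?exprn_gt0 ?mulr_gt0 ?ltr0n.
exists A => //; exists (A + C); first exact: addr_gt0.
move=> lambda l T l0 T0 ll0 L2 gbar.
have tp : 0 < T%:R :> R by rewrite ltr0n.
have dp : 0 < d%:R :> R by rewrite ltr0n.
have c0 : 0 < lambda ^- 2 by rewrite invr_gt0 exprn_gt0.
pose x := lambda ^- 2 * T%:R; have x0 : 0 < x by rewrite mulr_gt0.
have L2E : L2 = ln (1 + 2 * x) by rewrite /L2 /x -mulrA [_ * T%:R]mulrC.
have L20 : 0 < L2 by rewrite L2E ln_gt0// ltrDl mulr_gt0.
have Lx : ln (1 + x) <= L2.
  by rewrite L2E ler_ln ?posrE; lra.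
pose D := 2 * nu + d%:R; have D0 : 0 < D by rewrite addr_gt0// mulr_gt0.
pose y := T%:R / (lambda ^+ 2 * l `^ (2 * nu)).
have y0 : 0 < y by rewrite divr_gt0// mulr_gt0 ?powR_gt0 ?exprn_gt0.
(* The solution of [xi^(2 nu + d) = y / L2], which balances the cost [xi^d L2] of the grid and the
   error [y xi^(- 2 nu)]; [n] is [xi] rounded up. *)
pose xi := expR ((ln y - ln L2) / D).
have xi0 : 0 < xi by exact: expR_gt0.
have [n n1 n2] := ceil_nat (ltW xi0).
have np : 0 < n%:R :> R by exact: lt_le_trans n1.
have n0 : (0 < n)%N by rewrite -(ltr0n R).
have gE : y `^ (d%:R / D) * L2 `^ (2 * nu / D) = xi ^+ d * L2.
  rewrite /powR !gt_eqF// -[X in _ = _ * X]lnK ?posrE// -expRM_natl -!expRD.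
  by congr expR; rewrite /D; field; rewrite gt_eqF.
have xL0 : 0 <= xi ^+ d * L2 by rewrite mulr_ge0 ?exprn_ge0 ?ltW.
have gbarE : gbar = A * L2 + (A + C) * (xi ^+ d * L2).
  by rewrite /gbar -/y -/D -gE mulrA.
rewrite gbarE; split.
  by rewrite addr_ge0// mulr_ge0 ?(ltW L20) ?(ltW A0)// addr_ge0// ltW.
apply: info_gain_le => X X1.
have := hC l (lambda ^- 2) T n X ll0 c0 T0 n0 X1; rewrite -/x.
(* From [n <= xi + 1] and [(xi + 1)^d <= 2^d (xi^d + 1)]; the 1 produces the term of [gbar] linear
   in [L2]. *)
have hK : ((n * (Num.truncn nu).+1) ^ d)%:R * ln (1 + K%:R * x) <=
    A * L2 + A * (xi ^+ d * L2).
  rewrite natrX natrM.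
  apply: (@le_trans _ _ ((n%:R * (Num.truncn nu).+1%:R) ^+ d * (K%:R * L2))).
    rewrite ler_wpM2l ?exprn_ge0 ?mulr_ge0//.
    by apply: (le_trans (bernoulli_ln K (ltW x0))); rewrite ler_wpM2l.
  have -> : A * L2 + A * (xi ^+ d * L2) =
      2 ^+ d * (xi ^+ d + 1) * ((Num.truncn nu).+1%:R ^+ d * (K%:R * L2)).
    by rewrite /A exprMn; ring.
  rewrite exprMn -[leLHS]mulrA; apply: ler_wpM2r.
    by rewrite mulr_ge0 ?exprn_ge0 ?mulr_ge0 ?(ltW L20).
  apply: le_trans (expn_addr1_le d (ltW xi0)).
  by rewrite lerXn2r ?nnegrE ?addr_ge0 ?(ltW xi0).
have hy : x * ((l * n%:R) ^- 2) `^ nu <= xi ^+ d * L2.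
  have ln0 : 0 < l * n%:R by rewrite mulr_gt0.
  have -> : x = expR (ln y + 2 * nu * ln l).
    rewrite expRD lnK ?posrE// -ln_powR lnK ?posrE ?powR_gt0//.
    by rewrite /y /x; field; rewrite !gt_eqF ?powR_gt0.
  rewrite /powR gt_eqF ?invr_gt0 ?exprn_gt0// -expRD.
  rewrite lnV ?posrE ?exprn_gt0// lnXn// lnM ?posrE//.
  apply: (@le_trans _ _ (expR (ln y - 2 * nu * ln xi))).
    rewrite ler_expR -mulr_natl.
    have h : 0 <= nu * (ln n%:R - ln xi).
      by rewrite mulr_ge0 ?(ltW nu0)// subr_ge0 ler_ln ?posrE.
    lra.
  rewrite -[X in _ <= _ * X]lnK ?posrE// -expRM_natl -expRD ler_expR /xi expRK.
  rewrite le_eqVlt; apply/orP; left; apply/eqP.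
  by rewrite /D; field; rewrite gt_eqF.
have := ler_wpM2l (ltW C0) hy.
have := mulr_ge0 (ltW A0) (ltW L20).
have := mulr_ge0 (ltW A0) xL0.
have := mulr_ge0 (ltW C0) xL0.
rewrite mulrDl.
move: (C * (x * _)) (A * (xi ^+ d * L2)) (C * (xi ^+ d * L2)) (A * L2) hK => a1 a2 a3 a4.
move: (_%:R * ln (1 + K%:R * x)) => a5; lra.
Qed.

End matern_info_gain.

(** * Choice of the constants and assembly of the two bounds *)

Theorem theorem2 (R : realType) :
  (* absolute constant C and C_nu depending only on nu *)
  exists (C : R) (Cnu : R -> R),
    0 < C /\ (forall nu : R, 0 < Cnu nu) /\
  forall d : nat, (0 < d)%N ->
  (* constants depending only on d, and on (d, nu) *)
  exists (C1 C2 C3 C4 C5 : R) (Cdnu1 Cdnu2 : R -> R),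
    0 < C1 /\ 0 < C2 /\ 0 < C3 /\ 0 < C4 /\ 0 < C5 /\
    (forall nu : R, 0 < Cdnu1 nu) /\ (forall nu : R, 0 < Cdnu2 nu) /\
  forall (lambda : R) (T : nat), 0 < lambda -> (0 < T)%N ->
  let L := ln (1 + T%:R / lambda ^+ 2) in
  (* (i) squared exponential kernel *)
  (forall l : R, 0 < l ->
     let theta := 2 * l ^+ 2 in
     let cd := Num.max 1 (expR ((expR 1)^-1 * (d%:R / 2 - 1))) in
     (theta <= expR 1 ^+ 2 * cd -> T%:R / (expR 1 - 1) >= lambda ^+ 2 ->
        info_gain T (@k_SE R l d) lambda <=
          C1 / theta ^+ d * L ^+ d.+1 + L
          + C2 * expR (- (2 / theta) + 1 / theta ^+ 2)) /\
     (expR 1 ^+ 2 * cd < theta ->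
        info_gain T (@k_SE R l d) lambda <=
          C3 / (ln (theta / (expR 1 * cd))) ^+ d * L ^+ d.+1
          + C4 * L + C5)) /\
  (* (ii) Matern kernel *)
  (forall nu l : R, 2^-1 < nu -> 0 < l ->
     let CT := Num.max 1
       (log2 (1 + GammaR nu / Cnu nu * ln (T%:R ^+ 2 / lambda ^+ 2))
        + nu^-1 * log2 (T%:R ^+ 2 / (nu * GammaR nu * lambda ^+ 2)) + 1) in
     let L2 := ln (1 + 2 * T%:R / lambda ^+ 2) in
     let gbar := Cdnu1 nu * L2
       + Cdnu2 nu * (T%:R / (lambda ^+ 2 * l `^ (2 * nu))) `^ (d%:R / (2 * nu + d%:R))
         * L2 `^ (2 * nu / (2 * nu + d%:R)) in
     info_gain T (@k_Matern R nu l d) lambda <= CT * gbar + C).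
Proof.
exists 1, (fun=> 1); split=> //; split=> // d d0.
set cd := Num.max 1 (expR ((expR 1)^-1 * (d%:R / 2 - 1))).
have cd1 : 1 <= cd by rewrite le_max lexx.
have [C1 C10 hC1] := info_gain_SE_small R d.
have [C3 C30 hC3] := info_gain_SE_large R d.
have hM (nu : R) : exists C : R * R, 0 < C.1 /\ 0 < C.2 /\ (0 < nu ->
    forall (lambda l : R) T, 0 < lambda -> (0 < T)%N -> 0 < l ->
    let L2 := ln (1 + 2 * T%:R / lambda ^+ 2) in
    let gbar := C.1 * L2
       + C.2 * (T%:R / (lambda ^+ 2 * l `^ (2 * nu))) `^ (d%:R / (2 * nu + d%:R))
         * L2 `^ (2 * nu / (2 * nu + d%:R)) in
    0 <= gbar /\ info_gain T (@k_Matern R nu l d) lambda <= gbar + 1).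
  (* The constants are functions positive at every real [nu], so a default value 1 is given when
     [nu <= 0]. *)
  have [nu0|nu0] := leP nu 0; last first.
    by have [A A0 [B B0 h]] := info_gain_Matern nu0 d0; exists (A, B).
  by exists (1, 1); split=> //; split=> //; rewrite ltNge nu0.
have [Cm hCm] := choice hM.
have d1 : 0 < 1 + d%:R :> R by rewrite ltr_wpDr.
exists (C1 * cd ^+ d), (expR 1 * (1 + d%:R)), C3, C3, (1 + d%:R),
  (fun nu => (Cm nu).1), (fun nu => (Cm nu).2).
split; first by rewrite mulr_gt0// exprn_gt0//; lra.
split; first by rewrite mulr_gt0 ?expR_gt0.
do 3 (split=> //).
split; first by move=> nu; have [] := hCm nu.
split; first by move=> nu; have [_ []] := hCm nu.
move=> lambda T l0 T0 L; split=> [l ll0 theta cd'|nu l nu2 ll0]; last first.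
  have nu0 : 0 < nu by apply: lt_trans nu2; rewrite invr_gt0.
  have [_ [_ /(_ nu0 lambda l T l0 T0 ll0)]] := hCm nu; cbv zeta => -[g0 hg].
  (* The prefactor is at least 1 by its maximum, and it multiplies a nonnegative quantity. *)
  by apply: (le_trans hg); rewrite lerD2r ler_peMl// le_max lexx.
split=> [th hT|th]; last exact: hC3.
  have := hC1 _ _ _ _ l0 T0 ll0 cd1 th hT; rewrite -/theta -/L => /le_trans; apply.
  have L0 : 0 <= L by rewrite ln_ge0// lerDl divr_ge0 ?sqr_ge0.
  rewrite -addrA lerD2l; apply: ler_wpDl => //.
  rewrite mulrAC -expRD ler_peMl ?(ltW d1)// -[leLHS]expR0 ler_expR.
  have th0 : 0 < theta by rewrite mulr_gt0 ?exprn_gt0.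
  (* The factor [expR 1] in the second constant completes the exponent to a square, so the
     exponential term dominates [1 + d]. *)
  have -> : 1 + (- (2 / theta) + 1 / theta ^+ 2) = (1 - theta^-1) ^+ 2.
    by move: (theta) th0 => t t0; field; rewrite gt_eqF.
  exact: sqr_ge0.
Qed.
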